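(* Let $V\subseteq\mathbb{Z}^2$ be infinite and connected with $\mathbb{Z}^2\setminus V$ infinite and connected, let $E$ be the nearest-neighbour edges with both endpoints in $V$, and let $\mathbb{P}$ be a product measure on $[0,\infty)^E$ with i.i.d. marginals. Then for any $x,y\in V$, almost surely there exists a geodesic from $x$ to $y$ in $(V,E)$.
   Context: For $\omega\in[0,\infty)^E$, a path $\gamma$ in $(V,E)$ has passage time $\tau(\gamma)=\sum_{e\in\gamma}\omega_e$; $\tau(x,y)$ is the infimum of $\tau(\gamma)$ over paths from $x$ to $y$ in $(V,E)$; a geodesic from $x$ to $y$ is a path $\gamma$ from $x$ to $y$ with $\tau(\gamma)=\tau(x,y)$. *)

(* Defs.v *)
From HB Require Import structures.
From mathcomp Require Import all_boot all_order all_algebra.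
From mathcomp Require Import all_classical all_reals all_analysis.
Set Implicit Arguments. Unset Strict Implicit. Unset Printing Implicit Defensive.
Import Order.TTheory GRing.Theory Num.Theory.
Local Open Scope classical_set_scope.
Local Open Scope ring_scope.

Definition Z2 := (int * int)%type.

Definition adj (a b : Z2) : Prop := `|a.1 - b.1| + `|a.2 - b.2| = 1.

(* Undirected nearest-neighbour edges of Z^2: (v, false) is the edge
   {v, v + (1,0)} and (v, true) is the edge {v, v + (0,1)}; this is a
   bijection with the set of nearest-neighbour edges. *)
Definition Edge := (Z2 * bool)%type.
Definition src (e : Edge) : Z2 := e.1.
Definition dst (e : Edge) : Z2 :=
  if e.2 then (e.1.1, e.1.2 + 1) else (e.1.1 + 1, e.1.2).

Definition edge_of (u v : Z2) : Edge :=
  if v == (u.1 + 1, u.2) then (u, false)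
  else if u == (v.1 + 1, v.2) then (v, false)
  else if v == (u.1, u.2 + 1) then (u, true)
  else (v, true).

Definition edges_in (V : set Z2) : set Edge := [set e | V (src e) /\ V (dst e)].

Fixpoint is_path (V : set Z2) (x : Z2) (p : seq Z2) (y : Z2) : Prop :=
  match p with
  | [::] => V x /\ x = y
  | z :: p' => V x /\ adj x z /\ is_path V z p' y
  end.

Definition connected_set (V : set Z2) : Prop :=
  forall x y, V x -> V y -> exists p, is_path V x p y.

Fixpoint ptime {R : realType} (w : Edge -> R) (x : Z2) (p : seq Z2) : R :=
  match p with
  | [::] => 0
  | z :: p' => w (edge_of x z) + ptime w z p'
  end.

Definition tau {R : realType} (V : set Z2) (w : Edge -> R) (x y : Z2) : R :=
  inf [set ptime w x p | p in [set p | is_path V x p y]].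

Definition geodesic {R : realType} (V : set Z2) (w : Edge -> R)
  (x : Z2) (p : seq Z2) (y : Z2) : Prop :=
  is_path V x p y /\ ptime w x p = tau V w x y.

Definition mutually_independent {d : measure_display} {T : measurableType d}
  {R : realType} (P : probability T R) {I : eqType} (J : set I)
  (X : I -> T -> R) : Prop :=
  forall (s : seq I) (B : I -> set R),
    uniq s -> (forall i, i \in s -> J i) -> (forall i, measurable (B i)) ->
    P (\big[setI/setT]_(i <- s) (X i @^-1` B i)) =
    (\prod_(i <- s) P (X i @^-1` B i))%E.

Definition identically_distributed {d : measure_display} {T : measurableType d}
  {R : realType} (P : probability T R) {I : Type} (J : set I)
  (X : I -> T -> R) : Prop :=
  forall i j (B : set R), J i -> J j -> measurable B ->
    P (X i @^-1` B) = P (X j @^-1` B).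

(* Main.v *)
Require Import Defs.
From HB Require Import structures.
From mathcomp Require Import all_boot all_order all_algebra.
From mathcomp Require Import all_classical all_reals all_analysis.
From mathcomp Require Import zify ring lra.
Import Order.TTheory GRing.Theory Num.Theory.
Import numFieldNormedType.Exports.
Local Open Scope classical_set_scope.
Local Open Scope ring_scope.

(* Everything rests on Harris' theorem: fair bond percolation on Z^2 has no
   infinite cluster. If P(X_e = 0) < 1/2, then P(X_e <= eps) <= 1/2 for some
   eps > 0, so the clusters of edges of weight at most eps are finite, paths of
   bounded passage time stay in a bounded region, and the infimum is a minimum.
   If P(X_e = 0) >= 1/2, then the dual clusters of edges of positive weight are
   finite. Fix a path r from x to y. Any other path p forms with r a loop; let
   [wind] be its winding parity, a mod 2 function on faces that vanishes near
   the infinite connected complement of V. Let C be the union of the dual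
   clusters meeting r. Adding to p the boundaries of the faces outside C with
   odd winding replaces the part of p away from C by edges of the boundary of C,
   which have zero weight; a parity argument extracts from the resulting chain a
   path from x to y near C that is no longer than p, so again finitely many
   paths compete.

   Harris' theorem is obtained by contradiction: if the origin is joined to the
   boundary of every box with probability at least d > 0, then positive
   correlation and a gluing argument at well-chosen scales N join the origin to
   (4N, 0) inside a box of size of order N with probability at least c(d) > 0.
   By self-duality the annuli at these scales contain dual barriers with
   probability bounded below, so the one-arm probability tends to 0. *)

(** * Lattice edges and paths *)

Definition adjb (a b : Z2) : bool := `|a.1 - b.1| + `|a.2 - b.2| == 1.

Lemma adjP (a b : Z2) : reflect (adj a b) (adjb a b).
Proof. exact: eqP. Qed.

Lemma adjb_sym : symmetric adjb.
Proof. move=> a b; rewrite /adjb; lia. Qed.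

(** A case analysis on [adjbP] replaces a neighbour and the edge leading to it at once by one of
    four explicit forms. *)
Variant adj_spec (a : Z2) : Z2 -> Edge -> Prop :=
| AdjE : adj_spec a (a.1 + 1, a.2) (a, false)
| AdjW : adj_spec a (a.1 - 1, a.2) ((a.1 - 1, a.2), false)
| AdjN : adj_spec a (a.1, a.2 + 1) (a, true)
| AdjS : adj_spec a (a.1, a.2 - 1) ((a.1, a.2 - 1), true).

Lemma adjbP (a b : Z2) : adjb a b -> adj_spec a b (edge_of a b).
Proof.
case: a b => [a1 a2] [b1 b2]; rewrite /adjb /edge_of /= !xpair_eqE => H.
have [h|[h|[h|h]]] : (b1 = a1 + 1 /\ b2 = a2) \/ (b1 = a1 - 1 /\ b2 = a2) \/
  (b1 = a1 /\ b2 = a2 + 1) \/ (b1 = a1 /\ b2 = a2 - 1) by lia.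
- by case: h => -> ->; rewrite !eqxx /=; constructor.
- case: h => -> ->; have -> : (a1 - 1 == a1 + 1) = false by lia.
  by rewrite /= subrK !eqxx /=; exact: (AdjW (a1, a2)).
- case: h => -> ->; have -> : (a1 == a1 + 1) = false by lia.
  by rewrite /= !eqxx /=; exact: (AdjN (a1, a2)).
- case: h => -> ->; have -> : (a1 == a1 + 1) = false by lia.
  have -> : (a2 - 1 == a2 + 1) = false by lia.
  by rewrite /= andbF; exact: (AdjS (a1, a2)).
Qed.

Lemma edge_of_sym a b : adjb a b -> edge_of a b = edge_of b a.
Proof.
move=> h; case: (adjbP _ _ h) => {h b}; case: a => a1 a2;
  rewrite /edge_of /= !xpair_eqE.
- by have -> : (a1 == a1 + 1 + 1) = false by [lia]; rewrite !eqxx.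
- by rewrite subrK !eqxx.
- have -> : (a1 == a1 + 1) = false by lia.
  by have -> : (a2 == a2 + 1 + 1) = false by [lia]; rewrite andbF.
- have -> : (a1 == a1 + 1) = false by lia.
  by rewrite subrK !eqxx.
Qed.

Lemma edge_of_ends a b : adjb a b ->
  (a = src (edge_of a b) /\ b = dst (edge_of a b)) \/
  (b = src (edge_of a b) /\ a = dst (edge_of a b)).
Proof.
move=> h; case: (adjbP _ _ h); case: a {h} => a1 a2; rewrite /src /dst /=.
- by left. 
- by right; split=> //; congr pair; lia.
- by left.
- by right; split=> //; congr pair; lia.
Qed.

Lemma adjb_ends e : adjb (src e) (dst e).
Proof. case: e => [[a1 a2] []]; rewrite /adjb /src /dst /=; lia. Qed.

Lemma edge_of_src_dst e : edge_of (src e) (dst e) = e.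
Proof.
case: e => [[a1 a2] []]; rewrite /edge_of /src /dst /= !xpair_eqE ?eqxx //=.
by have -> : (a1 == a1 + 1) = false by lia.
Qed.

Definition edges (x : Z2) (p : seq Z2) : seq Edge := pairmap edge_of x p.

Lemma edges_cat x p q : edges x (p ++ q) = edges x p ++ edges (last x p) q.
Proof. exact: pairmap_cat. Qed.

Lemma ptimeE (R : realType) (w : Edge -> R) x p :
  ptime w x p = \sum_(e <- edges x p) w e.
Proof. by elim: p x => [|z p IH] x /=; rewrite ?big_nil ?big_cons ?IH. Qed.

Lemma is_pathP (V : set Z2) x p y :
  is_path V x p y <->
  [/\ path adjb x p, last x p = y & forall z, z \in x :: p -> V z].
Proof.
elim: p x => [|z p IH] x /=.
  split=> [[Vx <-]|[_ <- h]]; last by split=> //; apply: h; rewrite inE.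
  by split=> // z; rewrite inE => /eqP ->.
rewrite IH; split=> [[Vx [/adjP a [h1 h2 h3]]]|[/andP[/adjP a h1] h2 h3]].
  by split=> //; [rewrite a|move=> t; rewrite inE => /orP[/eqP ->|/h3]].
split; first by apply: h3; rewrite inE eqxx.
by do !split=> //; move=> t ht; apply: h3; rewrite inE ht orbT.
Qed.

(** * Crossing parities of lattice walks *)

(* The index [f = (i, j)] stands for the unit face with lower-left corner
   [(i, j)]; [nu x p f] is the parity of the crossings of the walk with the
   horizontal half-line going left from the centre of that face. *)
Definition nu x p (f : Z2) : bool :=
  odd (count (fun e : Edge => [&& e.2, e.1.2 == f.2 & e.1.1 <= f.1])
    (edges x p)).
Definition cnt x p (e : Edge) : bool := odd (count_mem e (edges x p)).

Lemma cnt_mem x p e : cnt x p e -> e \in edges x p.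
Proof. by rewrite /cnt -has_pred1 has_count; case: count. Qed.

(** One step to the right lengthens the half-line by exactly one vertical edge, the one separating
    the two faces. *)
Lemma nu_right x p i j : nu x p (i + 1, j) = nu x p (i, j) (+) cnt x p ((i + 1, j), true).
Proof.
rewrite /nu /cnt -oddD; congr odd.
elim: (edges x p) => //= -[[a b] c] s ->; rewrite !xpair_eqE /=.
by case: c => /=; lia.
Qed.

Lemma nu_cons x z p f : nu x (z :: p) f = nu x [:: z] f (+) nu z p f.
Proof. by rewrite /nu /= addn0 oddD. Qed.

Lemma cnt_cons x z p e : cnt x (z :: p) e = cnt x [:: z] e (+) cnt z p e.
Proof. by rewrite /cnt /= addn0 oddD. Qed.

(** The set of vertices [(a, j)] with [a <= i] is entered or left only upwards, downwards or through
    the edge [((i, j), false)]; the parity of all these passages depends only on which endpoints of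
    the walk lie in the set. *)
Lemma nu_up x p i j : path adjb x p ->
  nu x p (i, j) (+) nu x p (i, j - 1) =
  cnt x p ((i, j), false) (+) ((x.2 == j) && (x.1 <= i))
    (+) (((last x p).2 == j) && ((last x p).1 <= i)).
Proof.
elim: p x => [|z p IH] x; first by rewrite /nu /cnt /= addbb.
move=> /= /andP[a /IH {}IH]; rewrite ![nu x (z :: p) _]nu_cons cnt_cons.
move: IH; set A := nu z p _; set B := nu z p _; set C := cnt z p _; set D := _ && _.
set F := (_ == j) && _ => H.
suff : nu x [:: z] (i, j) (+) nu x [:: z] (i, j - 1) =
  cnt x [:: z] (i, j, false) (+) ((x.2 == j) && (x.1 <= i)) (+) D.
  move: H; case: A; case: B; case: C; case: D; case: F => //=; case: (nu _ _ _);
  case: (nu _ _ _); case: (cnt _ _ _); case: (_ && _) => //.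
rewrite /D /nu /cnt /= {H A B C D F}.
case: (adjbP _ _ a) => {a}; case: x => x1 x2 /=; rewrite ?xpair_eqE /=; lia.
Qed.

(** The half-line cuts the whole width of the walk, so its crossings are all the passages between
    heights [j] and [j + 1]. *)
Lemma nu_far_right x p i j : path adjb x p -> (forall z, z \in x :: p -> z.1 <= i) ->
  nu x p (i, j) = (x.2 <= j) (+) ((last x p).2 <= j).
Proof.
elim: p x => [|z p IH] x; first by rewrite /nu /= addbb.
move=> /= /andP[a /IH {}IH] h; rewrite nu_cons IH; last first.
  by move=> t ht; apply: h; rewrite inE ht orbT.
have hx := h x; have hz := h z; rewrite !inE !eqxx ?orbT /= in hx hz.
have {}hx := hx isT; have {}hz := hz isT.
suff -> : nu x [:: z] (i, j) = (x.2 <= j) (+) (z.2 <= j) by case: (z.2 <= j); lia.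
move: hx hz; rewrite /nu /= {IH h}.
case: (adjbP _ _ a) => {a}; case: x => x1 x2 /=; lia.
Qed.

Lemma nu_far_left x p i j : path adjb x p -> (forall z, z \in x :: p -> i < z.1) ->
  nu x p (i, j) = false.
Proof.
elim: p x => [|z p IH] x //.
move=> /= /andP[a /IH {}IH] h; rewrite nu_cons IH; last first.
  by move=> t ht; apply: h; rewrite inE ht orbT.
have hx := h x; have hz := h z; rewrite !inE !eqxx ?orbT /= in hx hz.
have {}hx := hx isT; have {}hz := hz isT.
move: hx hz; rewrite /nu /= {IH h}.
case: (adjbP _ _ a) => {a}; case: x => x1 x2 /=; lia.
Qed.

Lemma edges_mem x p e : path adjb x p -> e \in edges x p ->
  (src e \in x :: p) /\ (dst e \in x :: p).
Proof.
elim: p x => [|z p IH] x //= /andP[a /IH {}IH].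
rewrite inE => /orP[/eqP ->|/IH [h1 h2]].
  by case: (edge_of_ends _ _ a) => -[<- <-]; rewrite !inE !eqxx ?orbT.
by rewrite !(in_cons x) h1 h2 !orbT.
Qed.

Definition rev_walk (x : Z2) p := rev (belast x p).

Lemma rev_walk_path x p : path adjb x p -> path adjb (last x p) (rev_walk x p).
Proof.
rewrite /rev_walk => h; rewrite rev_path.
by rewrite (eq_path (e' := adjb)) // => a b; rewrite adjb_sym.
Qed.

Lemma rev_walk_last x p : last (last x p) (rev_walk x p) = x.
Proof. by case: p => [|z p] //=; rewrite /rev_walk /= rev_cons last_rcons. Qed.

Lemma rev_walk_mem x p z : (z \in last x p :: rev_walk x p) = (z \in x :: p).
Proof. by rewrite /rev_walk -rev_rcons -lastI mem_rev. Qed.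

Lemma rev_walk_edges x p : path adjb x p ->
  edges (last x p) (rev_walk x p) = rev (edges x p).
Proof.
elim: p x => [|z p IH] x //= /andP[a /IH {}IH].
rewrite /rev_walk /= rev_cons -cats1 edges_cat IH rev_cons -cats1 /=.
by rewrite -/(rev_walk z p) rev_walk_last edge_of_sym // adjb_sym.
Qed.

Lemma walk_first x p (S : pred Z2) : S (last x p) ->
  exists p1 p2, [/\ p = p1 ++ p2, S (last x p1) & forall z, z \in belast x p1 -> ~~ S z].
Proof.
elim: p x => [|z p IH] x /= hS; first by exists [::], [::].
have [Sx|nSx] := boolP (S x); first by exists [::], (z :: p).
have [p1 [p2 [-> h1 h2]]] := IH z hS.
exists (z :: p1), p2; split=> // t; rewrite /= inE => /orP[/eqP ->|/h2] //.
Qed.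

(** * Open connections in a configuration *)

Definition config := Edge -> bool.

Definition conn (w : config) (U : pred Z2) (x : Z2) (S : pred Z2) : Prop :=
  exists p, [/\ path adjb x p, all w (edges x p), all U (x :: p) & S (last x p)].

Lemma conn_sub (w w' : config) (U U' S S' : pred Z2) x :
  (forall e, w e -> w' e) -> (forall z, U z -> U' z) ->
  (forall z, U z -> S z -> S' z) -> conn w U x S -> conn w' U' x S'.
Proof.
move=> hw hU hS [p [h1 h2 h3 h4]]; exists p; split=> //.
- exact: sub_all h2.
- exact: sub_all h3.
- by apply: hS => //; move/allP: h3; apply; exact: mem_last.
Qed.

Lemma conn_trans w U x y S : conn w U x (pred1 y) -> conn w U y S -> conn w U x S.
Proof.
move=> [p [h1 h2 h3 /eqP h4]] [q [k1 k2 k3 k4]]; exists (p ++ q); split.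
- by rewrite cat_path h1 h4.
- by rewrite edges_cat all_cat h2 h4.
- by move: h3 k3 => /= /andP[-> h] /andP[_ k]; rewrite all_cat h.
- by rewrite last_cat h4.
Qed.

Lemma conn_sym w U x y : conn w U x (pred1 y) -> conn w U y (pred1 x).
Proof.
move=> [p [h1 h2 h3 /eqP <-]]; exists (rev_walk x p); split.
- exact: rev_walk_path.
- by rewrite rev_walk_edges // all_rev.
- by apply/allP => z; rewrite rev_walk_mem => /(allP h3).
- by rewrite /= rev_walk_last.
Qed.

Lemma conn_mem w (U : pred Z2) x p z : path adjb x p -> all w (edges x p) -> all U (x :: p) ->
  z \in x :: p -> conn w U x (pred1 z).
Proof.
move=> h1 h2 h3 hz; move: hz h1 h2 h3; case/splitPl => p1 p2 hp; rewrite cat_path edges_cat -cat_cons !all_cat.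
by move=> /andP[h1 _] /andP[h2 _] /andP[h3 _]; exists p1; split=> //; apply/eqP.
Qed.

Lemma conn_first w U x (S : pred Z2) : conn w U x S ->
  exists p, [/\ path adjb x p, all w (edges x p), all U (x :: p), S (last x p) &
     forall z, z \in belast x p -> ~~ S z].
Proof.
move=> [p [h1 h2 h3 h4]]; have [p1 [p2 [? k1 k2]]] := walk_first x p S h4; subst p.
move: h1 h2 h3; rewrite cat_path edges_cat -cat_cons !all_cat.
by move=> /andP[h1 _] /andP[h2 _] /andP[h3 _]; exists p1.
Qed.

Lemma cntF x p e : path adjb x p -> src e \notin x :: p \/ dst e \notin x :: p ->
  cnt x p e = false.
Proof.
move=> h hn; apply/negP => /cnt_mem /(edges_mem _ _ _ h) [h1 h2].
by case: hn => /negP.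
Qed.

(** A vertex is read as the face of which it is the lower-left corner. A step of [p] then crosses an
    edge with an endpoint on [p], hence no edge of [Q]. The endpoint terms of [nu_up] vanish because
    the ends of [Q] lie on the line [r], which [p] meets only at other points. *)
Lemma nu_constant A Q r v p : path adjb A Q -> A.1 = r -> (last A Q).1 = r ->
  path adjb v p -> (forall z, z \in v :: p -> z.1 <= r) ->
  (forall z, z \in v :: p -> z \notin A :: Q) ->
  nu A Q (last v p) = nu A Q v.
Proof.
move=> hQ hA hB; elim: p v => [|z p IH] v //= /andP[a hp] hle hd.
rewrite IH //; first last.
- by move=> t ht; apply: hd; rewrite inE ht orbT.
- by move=> t ht; apply: hle; rewrite inE ht orbT.
have corr (t : Z2) : t \notin A :: Q -> t.1 <= r ->
    ((A.2 == t.2) && (A.1 <= t.1) = false) *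
    (((last A Q).2 == t.2) && ((last A Q).1 <= t.1) = false).
  have e (T : Z2) : T.1 = r -> t.1 <= r -> T != t -> (T.2 == t.2) && (T.1 <= t.1) = false.
    by case: T t => [T1 T2] [t1 t2]; rewrite xpair_eqE /=; lia.
  move=> ht hr; split; apply: e => //; apply/eqP => et; move: ht; rewrite -et.
    by rewrite mem_head.
  by rewrite mem_last.
have hv := hd v; have hz := hd z; rewrite !in_cons !eqxx ?orbT /= in hv hz.
have {}hv := hv isT; have {}hz := hz isT.
have lv : v.1 <= r by apply: hle; rewrite mem_head.
have lz : z.1 <= r by apply: hle; rewrite !inE eqxx orbT.
move: hv hz lv lz {hd hle IH hp}; case: (adjbP _ _ a) => {a z}; case: v => v1 v2 /= hv hz lv lz.
- by rewrite nu_right cntF ?addbF //; left.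
- by rewrite -{2}(subrK 1 v1) nu_right subrK cntF ?addbF //; left; rewrite /src /= ?subrK.
- have := nu_up A Q v1 (v2 + 1) hQ; rewrite addrK.
  rewrite cntF; [|by []|by left].
  rewrite !(corr _ hz lz) /=.
  by case: (nu _ _ _); case: (nu _ _ _).
- have := nu_up A Q v1 v2 hQ.
  rewrite cntF; [|by []|by left].
  rewrite !(corr _ hv lv) /=.
  by case: (nu _ _ _); case: (nu _ _ _).
Qed.

(* A walk staying left of the line [x = r] and ending on it between the
   endpoints of a walk [Q] that starts and ends on that line meets [Q], since
   [nu] is constant along walks avoiding [Q]. *)
Lemma walk_meets A Q r v p : path adjb A Q -> A.1 = r -> (last A Q).1 = r ->
  (forall z, z \in A :: Q -> v.1 < z.1 <= r) ->
  path adjb v p -> (last v p).1 = r -> (forall z, z \in v :: p -> z.1 <= r) ->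
  (last A Q).2 <= (last v p).2 <= A.2 ->
  exists2 z, z \in v :: p & z \in A :: Q.
Proof.
move=> hQ hA hB hbox hp hr hle hend; apply: contrapT => hno.
have hdis z : z \in v :: p -> z \notin A :: Q.
  by move=> zp; apply/negP => zQ; apply: hno; exists z.
have := nu_constant _ _ _ _ _ hQ hA hB hp hle hdis.
rewrite [nu _ _ v](_ : _ = false); last first.
  by case: (v) hbox => v1 v2 hbox; apply: nu_far_left => // z /hbox /andP[].
have hl := hdis _ (mem_last v p).
have hAl : last v p != A by apply: contraNneq hl => ->; rewrite mem_head.
case: (last v p) hr hend hAl => l1 l2 /= -> hend hAl.
rewrite nu_far_right //; last by move=> z /hbox /andP[].
case: A hA hAl hend {hQ hB hbox hdis hl hno} => A1 A2 /= ->.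
rewrite xpair_eqE eqxx /=; lia.
Qed.

(** The two paths from [u], the first one reversed, form a walk with ends on the line [r] at or
    above [a] and at or below [b]. The path from [v] ends between them, so it meets that walk and
    hence the cluster of [u]. *)
Lemma conn_glue w (U U1 U2 S S1 S2 : pred Z2) u v r a b :
  conn w U1 v S -> conn w U2 u S1 -> conn w U2 u S2 ->
  (forall z, U1 z -> U z /\ z.1 <= r) ->
  (forall z, U2 z -> U z /\ v.1 < z.1 <= r) ->
  (forall z, U1 z -> S z -> z.1 = r /\ b <= z.2 <= a) ->
  (forall z, U2 z -> S1 z -> z.1 = r /\ a <= z.2) ->
  (forall z, U2 z -> S2 z -> z.1 = r /\ z.2 <= b) ->
  conn w U v (pred1 u).
Proof.
move=> [p [p1 p2 p3 p4]] [q [q1 q2 q3 q4]] [s [s1 s2 s3 s4]] hU1 hU2 hS hS1 hS2.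
have p5 := allP p3 _ (mem_last v p); have q5 := allP q3 _ (mem_last u q).
have s5 := allP s3 _ (mem_last u s).
have [lp hp] := hS _ p5 p4; have [lq hq] := hS1 _ q5 q4; have [ls hs] := hS2 _ s5 s4.
set A := last u q in lq hq *; set Q := rev_walk u q ++ s.
have hQ : path adjb A Q by rewrite cat_path rev_walk_path //= rev_walk_last.
have lQ : last A Q = last u s by rewrite last_cat rev_walk_last.
have mQ z : z \in A :: Q -> z \in u :: q \/ z \in u :: s.
  rewrite -cat_cons mem_cat rev_walk_mem => /orP[->|h]; first by left.
  by right; rewrite inE h orbT.
have UQ z : z \in A :: Q -> U2 z by move=> /mQ [/(allP q3)|/(allP s3)].
have [z zp zQ] : exists2 z, z \in v :: p & z \in A :: Q.
  apply: (walk_meets A Q r) => //.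
  - by rewrite lQ.
  - by move=> z /UQ /hU2 [].
  - by move=> z /(allP p3) /hU1 [].
  - by case/andP: hp => h1 h2; rewrite lQ (le_trans hs h1) (le_trans h2 hq).
have vz : conn w U v (pred1 z).
  apply: conn_mem zp => //; apply: sub_all p3 => t /hU1 [] //.
apply: conn_trans vz _; apply: conn_sym.
have sub (t : seq Z2) : all U2 t -> all U t by apply: sub_all => y /hU2 [].
by case: (mQ _ zQ) => h; apply: conn_mem h => //; apply: sub.
Qed.

(** * Planar duality *)

(* [dl] sends an edge between two faces (indexed as in [nu]) to the lattice
   edge that separates them. *)
Definition dl (e : Edge) : Edge :=
  if e.2 then ((e.1.1, e.1.2 + 1), false) else ((e.1.1 + 1, e.1.2), true).
Definition dli (e : Edge) : Edge :=
  if e.2 then ((e.1.1 - 1, e.1.2), false) else ((e.1.1, e.1.2 - 1), true).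

Lemma dlK : cancel dl dli.
Proof. by case=> [[a b] []]; rewrite /dl /dli /= addrK. Qed.

Lemma dliK : cancel dli dl.
Proof. by case=> [[a b] []]; rewrite /dl /dli /= subrK. Qed.

Definition endcorr (A f : Z2) := (A.2 == f.2) && (A.1 <= f.1).

Lemma nu_step A Q e : path adjb A Q ->
  nu A Q (dst e) = nu A Q (src e) (+) cnt A Q (dl e)
    (+) (e.2 && (endcorr A (dst e) (+) endcorr (last A Q) (dst e))).
Proof.
move=> hQ; case: e => [[i j] []]; rewrite /dst /src /dl /endcorr /=.
  have := nu_up A Q i (j + 1) hQ; rewrite addrK.
  by case: (nu _ _ _); case: (nu _ _ _); case: (cnt _ _ _); case: (_ && _); case: (_ && _).
by rewrite nu_right addbF.
Qed.

(** [nu] is constant along [D], which crosses no edge of [Q], yet it is even to the left of [Q] and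
    odd to the right. Row [y] of faces fills the heights from [y] to [y + 1], so the strict bound
    with [y1] puts the end of [Q] at or above the top of the strip. *)
Lemma dual_block w A Q f D y0 y1 : path adjb A Q -> all w (edges A Q) ->
  path adjb f D -> all (fun e => ~~ w (dl e)) (edges f D) ->
  A.2 <= y0 -> y1 < (last A Q).2 ->
  (forall z, z \in A :: Q -> f.1 < z.1 <= (last f D).1) ->
  (forall z, z \in f :: D -> y0 <= z.2 <= y1) -> False.
Proof.
move=> hQ wQ hD wD hA hB hx hy.
have : nu A Q (last f D) = nu A Q f.
  elim: D f hD wD hy {hx} => [|z D IH] f //= /andP[a hD] /andP[we wD] hy.
  rewrite IH //; last by move=> t ht; apply: hy; rewrite inE ht orbT.
  have c : cnt A Q (dl (edge_of f z)) = false.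
    by apply/negP => /cnt_mem /(allP wQ); apply/negP.
  have hs := nu_step A Q (edge_of f z) hQ; rewrite c addbF in hs.
  have h1 := hy f; have h2 := hy z; rewrite !in_cons !eqxx ?orbT in h1 h2.
  have {}h1 := h1 isT; have {}h2 := h2 isT.
  have ec (t : Z2) (b : bool) : (y0 <= t.2 <= y1 -> b -> y0 < t.2) ->
      y0 <= t.2 <= y1 -> b && (endcorr A t (+) endcorr (last A Q) t) = false.
    by rewrite /endcorr; case: b => //= h k; have := h k isT; lia.
  have hd : (edge_of f z).2 -> (dst (edge_of f z)).2 = (src (edge_of f z)).2 + 1.
    by case: (edge_of f z) => [[? ?] []].
  case: (edge_of_ends _ _ a) hs hd => -[<- <-] hs hd; move: hs; rewrite ec ?addbF //.
    by move=> _ /hd ->; move: h1; lia.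
  by move=> _ /hd ->; move: h2; lia.
rewrite [nu _ _ f](_ : _ = false); last first.
  by case: (f) hx => v1 v2 hx; apply: nu_far_left => // z /hx /andP[].
have := hy _ (mem_last f D); case: (last f D) hx => g1 g2 hx hg.
rewrite nu_far_right //; last by move=> z /hx /andP[].
by move: hA hB hg => /=; lia.
Qed.

(** * Fair coin expectations *)

Definition upd (w : config) (e : Edge) (b : bool) : config :=
  fun e' => if e' == e then b else w e'.

(** An iterated average over the listed coins, all other edges being frozen at [w], so that
    inequalities are proved by induction on the list. *)
Fixpoint expect {R : realType} (J : seq Edge) (f : config -> R) (w : config) : R :=
  if J is e :: J' then
    (expect J' f (upd w e true) + expect J' f (upd w e false)) / 2
  else f w.

Definition lec (w w' : config) := forall e, w e -> w' e.
Definition incf {R : realType} (f : config -> R) := forall w w', lec w w' -> f w <= f w'.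

Definition depf {X : Type} (f : config -> X) (S : pred Edge) :=
  forall w w' : config, (forall e, S e -> w e = w' e) -> f w = f w'.

Section Expect.
Context {R : realType}.
Implicit Types (f g : config -> R) (w : config) (J : seq Edge).

Lemma upd_lec w w' e (b b' : bool) : lec w w' -> (b -> b') -> lec (upd w e b) (upd w' e b').
Proof. by move=> h hb e'; rewrite /upd; case: eqP => // _; exact: h. Qed.

Lemma upd_comm w e e' b b' : e != e' -> upd (upd w e b) e' b' = upd (upd w e' b') e b.
Proof.
move=> h; apply/funext => a; rewrite /upd.
by case: (a =P e') => [->|//]; rewrite eq_sym (negPf h).
Qed.

Lemma expect_le J f g w : (forall w, f w <= g w) -> expect J f w <= expect J g w.
Proof.
move=> h; elim: J w => [|e J IH] w //=.
by rewrite ler_pM2r ?invr_gt0 // lerD.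
Qed.

Lemma eq_expect J f g w : (forall w, f w = g w) -> expect J f w = expect J g w.
Proof. by move=> /funext ->. Qed.

Lemma expectD J f g w : expect J (fun w => f w + g w) w = expect J f w + expect J g w.
Proof. by elim: J w => [|e J IH] w //=; rewrite !IH; field. Qed.

Lemma expectN J f w : expect J (fun w => - f w) w = - expect J f w.
Proof. by elim: J w => [|e J IH] w //=; rewrite !IH; field. Qed.

Lemma expect_cst J (c : R) w : expect J (fun=> c) w = c.
Proof. by elim: J w => [|e J IH] w //=; rewrite !IH; field. Qed.

Lemma expect_inc J f w w' : incf f -> lec w w' -> expect J f w <= expect J f w'.
Proof.
move=> hf; elim: J w w' => [|e J IH] w w' h /=; first exact: hf.
by rewrite ler_pM2r ?invr_gt0 // lerD // IH //; exact: upd_lec.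
Qed.

(** Harris' inequality. Both conditional averages increase with the current coin, so Chebyshev's
    inequality on two points gives the induction step. *)
Lemma expect_FKG J f g w : incf f -> incf g ->
  expect J f w * expect J g w <= expect J (fun w => f w * g w) w.
Proof.
move=> hf hg; elim: J w => [|e J IH] w //=.
have hw : lec (upd w e false) (upd w e true) by apply: upd_lec.
have := IH (upd w e true); have := IH (upd w e false).
have := expect_inc J f _ _ hf hw; have := expect_inc J g _ _ hg hw.
set a := expect J f _; set b := expect J f _; set c := expect J g _; set d := expect J g _.
set x := expect J _ _; set y := expect J _ _ => h1 h2 h3 h4.
have : 0 <= (b - a) * (d - c) by rewrite mulr_ge0 // subr_ge0.
move=> h5; nra.
Qed.

Lemma expect_swap e e' J f w : expect (e :: e' :: J) f w = expect (e' :: e :: J) f w.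
Proof.
have [->//|h] := eqVneq e e'.
by rewrite /= !(upd_comm _ _ _ _ _ h); field.
Qed.

Lemma expect_cons_rcons e J f w : expect (e :: J) f w = expect (rcons J e) f w.
Proof.
elim: J w => [|e' J IH] w //.
rewrite expect_swap [RHS]/=; by rewrite -!IH.
Qed.

Lemma expect_cat J J' f w : expect (J ++ J') f w = expect J (expect J' f) w.
Proof. by elim: J w => [|e J IH] w //=; rewrite !IH. Qed.

Lemma expect_catC J J' f w : expect (J ++ J') f w = expect (J' ++ J) f w.
Proof.
elim: J J' w => [|e J IH] J' w; first by rewrite cats0.
by rewrite cat_cons expect_cons_rcons rcons_cat IH cat_rcons.
Qed.

Lemma expect_perm J J' f w : perm_eq J J' -> expect J f w = expect J' f w.
Proof.
move=> h; move: w; apply: (catCA_perm_ind (P := fun s => forall w, expect J f w = expect s f w) _ h) => //.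
by move=> s1 s2 s3 IH w; rewrite IH !catA !(expect_cat (_ ++ _)) expect_catC.
Qed.

Lemma expect_indep J f w : (forall e, e \in J -> forall w b, f (upd w e b) = f w) ->
  expect J f w = f w.
Proof.
elim: J w => [|e J IH] w //= h.
have h' e' : e' \in J -> forall w b, f (upd w e' b) = f w.
  by move=> he; apply: h; rewrite inE he orbT.
by rewrite !IH // !h ?mem_head //; field.
Qed.

Lemma depf_upd (X : Type) (f : config -> X) (S : pred Edge) e b w : depf f S -> ~~ S e -> f (upd w e b) = f w.
Proof.
move=> h hS; apply: h => e' Se'; rewrite /upd; case: eqP => // ee.
by move: hS; rewrite -ee Se'.
Qed.

Lemma expect_base J f w w' : depf f (mem J) -> expect J f w = expect J f w'.
Proof.
move=> hf; suff : forall S, depf f S -> (forall e, S e -> e \notin J -> w e = w' e) ->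
    expect J f w = expect J f w'.
  by apply; [exact: hf|move=> e /= ->].
elim: J w w' {hf} => [|e J IH] v v' S hf hv /=.
  by apply: hf => e Se; apply: hv.
have k b : expect J f (upd v e b) = expect J f (upd v' e b).
  apply: (IH _ _ S) => // e' Se' nJ; rewrite /upd; case: (e' =P e) => // ne.
  by apply: hv => //; rewrite inE negb_or nJ andbT; apply/eqP.
by rewrite !k.
Qed.

Lemma expect_supp J J' f w w' : uniq J -> uniq J' -> depf f (mem J) -> depf f (mem J') ->
  expect J f w = expect J' f w'.
Proof.
have H (K K' : seq Edge) v : depf f (mem K') -> expect K f v = expect [seq e <- K | e \in K'] f v.
  move=> hf; rewrite -(expect_perm _ _ _ _ (introT permPl (perm_filterC (mem K') K))).
  rewrite expect_cat; congr expect; apply/funext => u; apply: expect_indep => e.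
  by rewrite mem_filter => /andP[he _] x b; apply: depf_upd hf he.
move=> uJ uJ' hJ hJ'; rewrite (H J J') // (H J' J) //.
rewrite (expect_perm _ [seq e <- J' | e \in J]); last first.
  apply: uniq_perm; rewrite ?filter_uniq // => e.
  by rewrite !mem_filter andbC.
rewrite -!H //; exact: expect_base.
Qed.

Lemma expect_map (s : Edge -> Edge) J f w : injective s ->
  expect (map s J) (fun w => f (w \o s)) w = expect J f (w \o s).
Proof.
move=> hs; elim: J w => [|e J IH] w //=.
have k b : upd w (s e) b \o s = upd (w \o s) e b.
  by apply/funext => a; rewrite /upd /= (inj_eq hs).
by rewrite !IH !k.
Qed.

Lemma expect_flip J f w : expect J (fun w => f (fun e => ~~ w e)) w =
  expect J f (fun e => ~~ w e).
Proof.
elim: J w => [|e J IH] w //=; rewrite !IH addrC.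
have k b : (fun a => ~~ upd w e b a) = upd (fun a => ~~ w a) e (~~ b).
  by apply/funext => a; rewrite /upd; case: eqP.
by rewrite !k.
Qed.

(** Each coin influences only one of the two factors. *)
Lemma expect_prod J f g (S : pred Edge) w : depf f S -> depf g (predC S) ->
  expect J (fun w => f w * g w) w = expect J f w * expect J g w.
Proof.
move=> hf hg; elim: J w => [|e J IH] w //=; rewrite !IH.
have k (h : config -> R) (T : pred Edge) b : depf h T -> ~~ T e -> expect J h (upd w e b) = expect J h w.
  move=> hh nT; elim: J w {IH} => [|e' J IH] u /=; first exact: depf_upd hh nT.
  have [<-|ne] := eqVneq e e'.
    have k2 c : upd (upd u e b) e c = upd u e c.
      by apply/funext => a; rewrite /upd; case: eqP.
    by rewrite !k2.
  by rewrite !(upd_comm _ _ _ _ _ ne) !IH.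
have [Se|nSe] := boolP (S e).
  by rewrite !(k g (predC S)) /= ?Se //; field.
by rewrite !(k f S) //; field.
Qed.

End Expect.

(** * Finite boxes and local events *)

Definition inbox (n : nat) (z : Z2) : bool := (`|z.1| <= n%:Z) && (`|z.2| <= n%:Z).
Definition irange (n : nat) : seq int := [seq i%:Z - n%:Z | i <- iota 0 (n + n).+1].
Definition boxV (n : nat) : seq Z2 := [seq (a, b) | a <- irange n, b <- irange n].
Definition boxE (n : nat) : seq Edge := [seq (z, b) | z <- boxV n, b <- [:: true; false]].

Lemma mem_irange n z : (z \in irange n) = (`|z| <= n%:Z).
Proof.
apply/mapP/idP => [[i]|h]; first by rewrite mem_iota => h ->; lia.
exists (absz (z + n%:Z)); last by lia.
rewrite mem_iota; lia.
Qed.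

Lemma uniq_irange n : uniq (irange n).
Proof. by rewrite map_inj_uniq ?iota_uniq // => i j /addIr []. Qed.

Lemma mem_boxV n z : (z \in boxV n) = inbox n z.
Proof.
rewrite /inbox -!mem_irange; case: z => a b.
apply/allpairsP/andP => /= [[[x y] /= [h1 h2 [-> ->]]]|[h1 h2]]; first by [].
by exists (a, b).
Qed.

Lemma mem_boxE n e : (e \in boxE n) = inbox n (src e).
Proof.
rewrite -mem_boxV; case: e => z b /=.
apply/allpairsP/idP => /= [[[x y] /= [h1 h2 [-> _]]]|h1]; first by [].
by exists (z, b); split=> //=; case: b.
Qed.

Lemma uniq_boxE n : uniq (boxE n).
Proof.
apply: allpairs_uniq => //; last by move=> [? ?] [? ?] _ _ [-> ->].
by apply: allpairs_uniq; rewrite ?uniq_irange // => -[? ?] [? ?] _ _ [-> ->].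
Qed.

Lemma inbox_le m n z : (m <= n)%N -> inbox m z -> inbox n z.
Proof. rewrite /inbox; lia. Qed.

Lemma seq_bound (T : eqType) (Q : T -> nat -> Prop) (s : seq T) :
  (forall x m n, (m <= n)%N -> Q x m -> Q x n) ->
  (forall x, x \in s -> exists n, Q x n) -> exists n, forall x, x \in s -> Q x n.
Proof.
move=> mono; elim: s => [|x s IH] h; first by exists 0.
have [|n hn] := IH; first by move=> y ys; apply: h; rewrite inE ys orbT.
have [m hm] := h x (mem_head _ _).
exists (maxn m n) => y; rewrite inE => /orP[/eqP ->|/hn].
  by apply: mono hm; exact: leq_maxl.
by apply: mono; exact: leq_maxr.
Qed.

Lemma inbox_ex z : exists n, inbox n z.
Proof. exists (`|z.1|%N + `|z.2|%N)%N; rewrite /inbox; lia. Qed.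

Lemma inbox_seq (s : seq Z2) : exists n, forall z, z \in s -> inbox n z.
Proof.
apply: (seq_bound _ (fun z n => inbox n z)) => [z m n|z _]; first exact: inbox_le.
exact: inbox_ex.
Qed.

Arguments boxE : simpl never.
Arguments boxV : simpl never.
Arguments irange : simpl never.

Definition boxdep (n : nat) : pred Edge := fun e => inbox n (src e).
Definition fdep (A : config -> Prop) := exists n, depf A (boxdep n).
Definition incp (A : config -> Prop) := forall w w', lec w w' -> A w -> A w'.

Lemma depf_sub (X : Type) (f : config -> X) (S S' : pred Edge) :
  (forall e, S e -> S' e) -> depf f S -> depf f S'.
Proof. by move=> h hf w w' hw; apply: hf => e /h; exact: hw. Qed.

Lemma depf_box_le (X : Type) (f : config -> X) m n : (m <= n)%N -> depf f (boxdep m) -> depf f (boxdep n).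
Proof. by move=> h; apply: depf_sub => e; exact: inbox_le. Qed.

Lemma depf_and (A B : config -> Prop) S : depf A S -> depf B S -> depf (fun w => A w /\ B w) S.
Proof. by move=> hA hB w w' h; rewrite (hA _ _ h) (hB _ _ h). Qed.

Lemma fdep2 (A B : config -> Prop) : fdep A -> fdep B ->
  exists n, depf A (boxdep n) /\ depf B (boxdep n).
Proof.
move=> [n hn] [m hm]; exists (maxn m n); split.
  by apply: depf_box_le hn; exact: leq_maxr.
by apply: depf_box_le hm; exact: leq_maxl.
Qed.

Lemma fdep_and A B : fdep A -> fdep B -> fdep (fun w => A w /\ B w).
Proof. by move=> /fdep2 h /h [n [hA hB]]; exists n; exact: depf_and. Qed.

Lemma fdep_or A B : fdep A -> fdep B -> fdep (fun w => A w \/ B w).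
Proof.
move=> /fdep2 h /h [n [hA hB]]; exists n => w w' hw.
by rewrite (hA _ _ hw) (hB _ _ hw).
Qed.

Lemma fdep_not A : fdep A -> fdep (fun w => ~ A w).
Proof. by move=> [n h]; exists n => w w' hw; rewrite (h _ _ hw). Qed.

Lemma fdep_flip A : fdep A -> fdep (fun w => A (fun e => ~~ w e)).
Proof. by move=> [n h]; exists n => w w' hw; apply: h => e /hw ->. Qed.

Lemma fdep_comp (s : Edge -> Edge) A : fdep A -> fdep (fun w => A (w \o s)).
Proof.
move=> [n h]; have [m hm] := inbox_seq [seq src (s e) | e <- boxE n].
exists m => w w' hw; apply: h => e he; apply: hw; apply: hm.
by apply/mapP; exists e; rewrite ?mem_boxE.
Qed.

(** * Probability of local events under fair coins *)

Section Pr.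
Context {R : realType}.

Definition ind (A : config -> Prop) (w : config) : R := `[< A w >]%:R.
(* Junk value unless [fdep A]; the box chosen by [xget] is irrelevant, see [prE]. *)
Definition pr (A : config -> Prop) : R :=
  expect (boxE (xget 0%N [set n | depf A (boxdep n)])) (ind A) (fun=> false).

Lemma depf_ind A S : depf A S -> depf (ind A) S.
Proof. by move=> h w w' hw; rewrite /ind (h _ _ hw). Qed.

Lemma prE n A : depf A (boxdep n) -> pr A = expect (boxE n) (ind A) (fun=> false).
Proof.
move=> h; rewrite /pr; case: xgetP => [m _ /= hm|/(_ n)/(_ h)//].
have k p : depf A (boxdep p) -> depf (ind A) (mem (boxE p)).
  by move=> hp; apply: depf_ind; apply: depf_sub hp => e /=; rewrite mem_boxE.
exact (expect_supp _ _ _ _ _ (uniq_boxE _) (uniq_boxE _) (k _ hm) (k _ h)).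
Qed.

Lemma pr_ge0 A : 0 <= pr A.
Proof.
rewrite /pr -[leLHS](expect_cst (boxE (xget 0%N [set n | depf A (boxdep n)])) 0 (fun=> false)).
by apply: expect_le => w; rewrite /ind.
Qed.

Lemma pr_le1 A : pr A <= 1.
Proof.
rewrite /pr -[leRHS](expect_cst (boxE (xget 0%N [set n | depf A (boxdep n)])) 1 (fun=> false)).
by apply: expect_le => w; rewrite /ind lern1; case: asbool.
Qed.

Lemma pr_le A B : fdep A -> fdep B -> (forall w, A w -> B w) -> pr A <= pr B.
Proof.
move=> /fdep2 h /h [n [hA hB]] hAB; rewrite (prE n) // (prE n) //.
apply: expect_le => w; rewrite /ind ler_nat.
by case: asboolP => // /hAB /asboolP ->.
Qed.

Lemma pr_False A : (forall w, ~ A w) -> pr A = 0.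
Proof.
move=> h; rewrite /pr (eq_expect _ _ (fun=> 0)) ?expect_cst // => w.
by rewrite /ind; case: asboolP => // /h.
Qed.

Lemma pr_or A B : fdep A -> fdep B -> pr (fun w => A w \/ B w) <= pr A + pr B.
Proof.
move=> /fdep2 h /h [n [hA hB]]; rewrite !(prE n) //; last first.
  by move=> w w' hw; rewrite (hA _ _ hw) (hB _ _ hw).
rewrite -expectD; apply: expect_le => w; rewrite /ind -natrD ler_nat.
by case: asboolP => // -[] /asboolP ->; lia.
Qed.

Lemma pr_not A : fdep A -> pr (fun w => ~ A w) = 1 - pr A.
Proof.
move=> [n hA]; rewrite !(prE n) //; last first.
  by move=> w w' hw; rewrite (hA _ _ hw).
rewrite -[X in X - _](expect_cst (boxE n) 1 (fun=> false)) -expectN -expectD.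
apply: eq_expect => w; rewrite /ind asbool_neg; case: asbool; rewrite ?subrr ?subr0 //.
Qed.

Lemma ind_inc A : incp A -> incf (ind A).
Proof.
by move=> h w w' /h hw; rewrite /ind ler_nat; case: asboolP => // /hw /asboolP ->.
Qed.

Lemma ind_and A B w : ind (fun w => A w /\ B w) w = ind A w * ind B w.
Proof. by rewrite /ind asbool_and -natrM mulnb. Qed.

Lemma pr_FKG A B : fdep A -> fdep B -> incp A -> incp B ->
  pr A * pr B <= pr (fun w => A w /\ B w).
Proof.
move=> /fdep2 h /h [n [hA hB]] iA iB; rewrite !(prE n) //; last exact: depf_and.
have -> : ind (fun w => A w /\ B w) = (fun w => ind A w * ind B w).
  by apply/funext => w; rewrite ind_and.
by apply: expect_FKG; exact: ind_inc.
Qed.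

Lemma pr_indep A B S : fdep A -> fdep B -> depf A S -> depf B (predC S) ->
  pr (fun w => A w /\ B w) = pr A * pr B.
Proof.
move=> /fdep2 h /h [n [hA hB]] iA iB; rewrite !(prE n) //; last exact: depf_and.
have -> : ind (fun w => A w /\ B w) = (fun w => ind A w * ind B w).
  by apply/funext => w; rewrite ind_and.
by apply: (expect_prod _ _ _ S); exact: depf_ind.
Qed.

Lemma pr_flip A : fdep A -> pr (fun w => A (fun e => ~~ w e)) = pr A.
Proof.
move=> [n hA]; rewrite !(prE n) //; last by move=> w w' hw; apply: hA => e /hw ->.
rewrite -[LHS]/(expect (boxE n) (fun w => ind A (fun e => ~~ w e)) _) expect_flip.
apply: expect_base; apply: depf_ind; apply: depf_sub hA => e /=; by rewrite mem_boxE.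
Qed.

(** An injective relabelling sends independent fair coins to independent fair coins; this serves
    both for lattice symmetries and for [dl]. *)
Lemma pr_comp (s : Edge -> Edge) A : injective s -> fdep A -> pr (fun w => A (w \o s)) = pr A.
Proof.
move=> hs hA; have [m hm] := fdep_comp s _ hA; case: hA => n hA.
rewrite (prE m) // (prE n) //.
have hA' : depf (ind A) (mem (boxE n)).
  by apply: depf_ind; apply: depf_sub hA => e /=; rewrite mem_boxE.
rewrite (expect_supp _ (map s (boxE n)) _ _ (fun=> false)); last first.
- by move=> w w' hw; apply: hA' => e he; apply: hw; apply: map_f.
- by apply: depf_ind; apply: depf_sub hm => e /=; rewrite mem_boxE.
- by rewrite map_inj_uniq // uniq_boxE.
- exact: uniq_boxE.
rewrite -[LHS]/(expect _ (fun w => ind A (w \o s)) _) expect_map //.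
Qed.

End Pr.

Lemma conn_inc U x S : incp (fun w => conn w U x S).
Proof. by move=> w w' h; apply: conn_sub. Qed.

Lemma conn_dep (U : pred Z2) x S :
  depf (fun w => conn w U x S) (fun e => U (src e) && U (dst e)).
Proof.
have H w w' : (forall e, U (src e) && U (dst e) -> w e = w' e) -> conn w U x S -> conn w' U x S.
  move=> h [p [h1 h2 h3 h4]]; exists p; split=> //.
  apply/allP => e he; have [e1 e2] := edges_mem _ _ _ h1 he.
  by rewrite -h ?(allP h3) // (allP h2).
move=> w w' h; apply/propext; split; apply: H => // e he; by rewrite h.
Qed.

Lemma conn_fdep (U : pred Z2) x S n : (forall z, U z -> inbox n z) ->
  fdep (fun w => conn w U x S).
Proof.
move=> h; exists n; apply: depf_sub (conn_dep U x S) => e /andP[he _]; exact: h.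
Qed.

(** * Lattice symmetries *)

Definition lattice_map (s : Z2 -> Z2) :=
  injective s /\ forall a b, adjb a b -> adjb (s a) (s b).
Definition emap (s : Z2 -> Z2) (e : Edge) : Edge := edge_of (s (src e)) (s (dst e)).

Lemma emap_edge s a b : lattice_map s -> adjb a b ->
  emap s (edge_of a b) = edge_of (s a) (s b).
Proof.
move=> [_ hs] h; rewrite /emap; case: (edge_of_ends _ _ h) => -[<- <-] //.
by rewrite edge_of_sym //; apply: hs; rewrite adjb_sym.
Qed.

Lemma emap_inj s : lattice_map s -> injective (emap s).
Proof.
move=> [si hs] e e' h.
have h1 := edge_of_ends _ _ (hs _ _ (adjb_ends e)).
have h2 := edge_of_ends _ _ (hs _ _ (adjb_ends e')).
rewrite -![edge_of (s _) _]/(emap _ _) -h in h1 h2.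
rewrite -(edge_of_src_dst e) -(edge_of_src_dst e').
have ae := adjb_ends e'.
by case: h1 => -[<- <-] in h2; case: h2 => -[/si <- /si <-] //; rewrite edge_of_sym // adjb_sym.
Qed.

Lemma conn_emap s w (U : pred Z2) x (S U' S' : pred Z2) : lattice_map s -> (forall z, U z -> U' (s z)) ->
  (forall z, U z -> S z -> S' (s z)) ->
  conn (w \o emap s) U x S -> conn w U' (s x) S'.
Proof.
move=> hs hU hS [p [h1 h2 h3 h4]]; exists (map s p); split.
- have sub a b : adjb a b -> adjb (s a) (s b) by case: hs => _; apply.
  rewrite path_map; apply: sub_path h1 => a b; exact: sub.
- elim: p x h1 h2 {h3 h4} => [|z p IH] x //= /andP[a h1] /andP[h2 h3].
  by rewrite IH // andbT; move: h2; rewrite emap_edge.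
- by rewrite -map_cons all_map; apply: sub_all h3.
- rewrite last_map; apply: hS => //; move/allP: h3; apply; exact: mem_last.
Qed.

(** Combines invariance under a symmetry with the enlargement of the region and of the target. *)
Lemma pr_conn_map (R : realType) s n m (U : pred Z2) x (S U' S' : pred Z2) : lattice_map s ->
  (forall z, U z -> inbox n z) -> (forall z, U' z -> inbox m z) ->
  (forall z, U z -> U' (s z)) ->
  (forall z, U z -> S z -> S' (s z)) ->
  pr (fun w => conn w U x S) <= pr (fun w => conn w U' (s x) S') :> R.
Proof.
move=> hs hU hU' hUU hSS; have hA := conn_fdep U x S n hU.
rewrite -(pr_comp _ _ (emap_inj _ hs) hA).
apply: pr_le; [exact: (fdep_comp _ _ hA)|exact: (conn_fdep _ _ _ m)|].
by move=> w; exact: conn_emap.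
Qed.

Definition org : Z2 := (0, 0).
Definition shift (v z : Z2) : Z2 := (z.1 + v.1, z.2 + v.2).
Definition refl_y (z : Z2) : Z2 := (z.1, - z.2).
Definition refl_x (c : int) (z : Z2) : Z2 := (c - z.1, z.2).
Definition swap (z : Z2) : Z2 := (z.2, z.1).
Definition antiswap (z : Z2) : Z2 := (- z.2, - z.1).

Ltac lattice_map_tac := split; [move=> [? ?] [? ?] /= [? ?]; congr pair; lia
  | move=> [? ?] [? ?]; rewrite /adjb /=; lia].

Lemma shift_lattice v : lattice_map (shift v). Proof. lattice_map_tac. Qed.
Lemma refl_y_lattice : lattice_map refl_y. Proof. lattice_map_tac. Qed.
Lemma refl_x_lattice c : lattice_map (refl_x c). Proof. lattice_map_tac. Qed.
Lemma swap_lattice : lattice_map swap. Proof. lattice_map_tac. Qed.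
Lemma antiswap_lattice : lattice_map antiswap. Proof. lattice_map_tac. Qed.

Definition bdry (N : nat) : pred Z2 := fun z => (`|z.1| == N%:Z) || (`|z.2| == N%:Z).

Lemma conn_or w (U : pred Z2) x (S S1 S2 : pred Z2) : (forall z, U z -> S z -> S1 z || S2 z) ->
  conn w U x S -> conn w U x S1 \/ conn w U x S2.
Proof.
move=> h [p [h1 h2 h3 h4]].
have /orP[h5|h5] := h _ (allP h3 _ (mem_last x p)) h4; by [left; exists p|right; exists p].
Qed.

Lemma conn_exit w M N x (c : Z2) : (N <= M)%N -> inbox N (shift c x) ->
  conn w (fun z => inbox M (shift c z)) x (fun z => bdry M (shift c z)) ->
  conn w (fun z => inbox N (shift c z)) x (fun z => bdry N (shift c z)).
Proof.
(* The walk is stopped on its first visit to the boundary of the small box or to its outside. It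
   surely visits this set, and since it cannot jump over the boundary, the first visit is on the
   boundary. *)
move=> NM xN h; pose S z := bdry N (shift c z) || ~~ inbox N (shift c z).
have : conn w (fun z => inbox M (shift c z)) x S.
  apply: conn_sub h => // z _; rewrite /S /bdry /inbox; lia.
move=> /conn_first [p [h1 h2 h3 h4 h5]].
have hp : forall z, z \in x :: p -> inbox N (shift c z).
  elim: p x xN h1 {h h2 h3 h4} h5 => [|z p IH] x xN /=; first by move=> _ _ z; rewrite inE => /eqP ->.
  move=> /andP[a h1] h5 t; rewrite inE => /orP[/eqP -> //|].
  have zN : inbox N (shift c z).
    have := h5 x (mem_head _ _); move: xN a; rewrite /S /inbox /bdry /adjb /shift /=; lia.
  by apply: (IH _ zN h1) => y hy; apply: h5; rewrite inE hy orbT.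
exists p; split=> //; first exact/allP.
by move: h4; rewrite /S (hp _ (mem_last x p)) orbF.
Qed.

Definition rect (a b c d : int) : pred Z2 := fun z => (a <= z.1 <= b) && (c <= z.2 <= d).

Lemma rect_inbox a b c d : exists n, forall z, rect a b c d z -> inbox n z.
Proof.
exists (absz a + absz b + absz c + absz d)%N => z; rewrite /rect /inbox; lia.
Qed.

Lemma rect_fdep a b c d x S : fdep (fun w => conn w (rect a b c d) x S).
Proof. have [n hn] := rect_inbox a b c d; exact: conn_fdep hn. Qed.

Lemma inbox_fdep n x S : fdep (fun w => conn w (inbox n) x S).
Proof. exact: (conn_fdep _ _ _ n). Qed.

(** * The one-arm probability and the landing point of the arm *)

Section OneArm.
Context {R : realType}.
Local Notation pr := (@pr R).

Lemma pr_conn_split (n : nat) (U : pred Z2) x (S S1 S2 : pred Z2) : (forall z, U z -> inbox n z) ->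
  (forall z, U z -> S z -> S1 z || S2 z) ->
  pr (fun w => conn w U x S) <= pr (fun w => conn w U x S1) + pr (fun w => conn w U x S2).
Proof.
move=> hU hS; have d T := conn_fdep U x T n hU.
apply: le_trans (pr_or _ _ (d S1) (d S2)); apply: pr_le (d S) _ _; first exact: fdep_or.
by move=> w; exact: conn_or.
Qed.

Definition theta (N : nat) : R := pr (fun w => conn w (inbox N) org (bdry N)).

Definition side (N k : nat) : pred Z2 := fun z => (z.1 == N%:Z) && (k%:Z <= z.2).

(** Symmetries carry each of the eight half-sides of the box to the upper half of its right side. *)
Lemma theta_side N : theta N <= 8 * pr (fun w => conn w (inbox N) org (side N 0)).
Proof.
set q := pr _.
pose P (S : pred Z2) := pr (fun w => conn w (inbox N) org S).
have split (S S1 S2 : pred Z2) : (forall z, inbox N z -> S z -> S1 z || S2 z) -> P S <= P S1 + P S2.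
  exact: (pr_conn_split N).
have sym s (S S' : pred Z2) : lattice_map s -> s org = org -> (forall z, inbox N z -> inbox N (s z)) ->
    (forall z, inbox N z -> S z -> S' (s z)) -> P S <= P S'.
  by move=> hs so h1 h2; rewrite /P -{2}so; apply: (pr_conn_map _ _ N N).
have hE : P (fun z => z.1 == N%:Z) <= 2 * q.
  have h1 := split (fun z => z.1 == N%:Z) (side N 0) (fun z => (z.1 == N%:Z) && (z.2 <= 0)).
  have h2 : P (fun z => (z.1 == N%:Z) && (z.2 <= 0)) <= q.
    apply: (sym refl_y); [exact: refl_y_lattice|by []|..];
      move=> z; rewrite /inbox /side /refl_y /=; lia.
  suff : P (fun z => z.1 == N%:Z) <= q + P (fun z => (z.1 == N%:Z) && (z.2 <= 0)) by lra.
  apply: h1 => z _; rewrite /side; lia.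
have hW : P (fun z => z.1 == - N%:Z) <= P (fun z => z.1 == N%:Z).
  apply: (sym (refl_x 0)); [exact: refl_x_lattice|by []|..];
    move=> z; rewrite /inbox /side /refl_x /=; lia.
have hN : P (fun z => z.2 == N%:Z) <= P (fun z => z.1 == N%:Z).
  apply: (sym swap); [exact: swap_lattice|by []|..];
    move=> z; rewrite /inbox /side /swap /=; lia.
have hS : P (fun z => z.2 == - N%:Z) <= P (fun z => z.1 == N%:Z).
  apply: (sym antiswap); [exact: antiswap_lattice|by []|..];
    move=> z; rewrite /inbox /side /antiswap /=; lia.
have h1 : theta N <= P (fun z => `|z.1| == N%:Z) + P (fun z => `|z.2| == N%:Z).
  by apply: split => z _.
have h2 : P (fun z => `|z.1| == N%:Z) <= P (fun z => z.1 == N%:Z) + P (fun z => z.1 == - N%:Z).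
  by apply: split => z _; lia.
have h3 : P (fun z => `|z.2| == N%:Z) <= P (fun z => z.2 == N%:Z) + P (fun z => z.2 == - N%:Z).
  by apply: split => z _; lia.
lra.
Qed.

Definition seg (N : nat) (b a : int) : pred Z2 := fun z => (z.1 == N%:Z) && (b <= z.2 <= a).

(** [al] is the largest height from which upwards the right side is still reached with probability
    at least [a]. The upper half-side has probability at least [2 * a] by [theta_side], and its part
    from [al + 1] on less than [a], which leaves at least [a] for the segment. *)
Lemma alpha_exists (a : R) N : 16 * a <= theta N -> 0 < a -> exists al : nat,
  [/\ (al <= N)%N, a <= pr (fun w => conn w (inbox N) org (side N al))
    & a <= pr (fun w => conn w (inbox N) org (seg N 0 al%:Z))].
Proof.
move=> ha a0; pose q k := pr (fun w => conn w (inbox N) org (side N k)).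
have q0 : 2 * a <= q 0%N by have := theta_side N; rewrite -/(q 0%N); lra.
have qN k : (N < k)%N -> q k <= 0.
  move=> hk; rewrite /q pr_False // => w [p [_ _ h3 h4]].
  move: (allP h3 _ (mem_last _ p)) h4; rewrite /inbox /side.
  case: (last _ p) => u v /=; clear -hk; lia.
have [||al hal hmax] := @ex_maxnP (fun k => `[< a <= q k >]) N.
- by exists 0%N; apply/asboolP; lra.
- move=> k /asboolP hk; rewrite leqNgt; apply/negP => /qN; lra.
exists al; move/asboolP: hal => hal; split=> //.
  rewrite leqNgt; apply/negP => /qN; lra.
have h1 : q 0%N <= pr (fun w => conn w (inbox N) org (seg N 0 al%:Z)) + q al.+1.
  apply: (pr_conn_split N) => // z _; rewrite /side /seg; lia.
have h2 : q al.+1 < a.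
  rewrite ltNge; apply/negP => h; have := hmax al.+1 (introT (asboolP _) h).
  by rewrite ltnn.
lra.
Qed.
End OneArm.

(** Otherwise [al] would more than quadruple whenever its argument triples, and outgrow the bound
    [al N <= N]. *)
Lemma subgeometric_step (al : nat -> nat) N0 : (forall N, al N <= N)%N ->
  exists N, [/\ (N0 <= N)%N, (0 < N)%N & (al (3 * N) <= 4 * al N)%N].
Proof.
move=> h; apply: contrapT => hno; pose N1 := N0.+1.
have big N : (N1 <= N)%N -> (4 * al N < al (3 * N))%N.
  move=> hN; rewrite ltnNge; apply/negP => k; apply: hno; exists N; split=> //.
    exact: ltnW.
  exact: leq_ltn_trans hN.
have N1k k : (N1 <= 3 ^ k * N1)%N by rewrite leq_pmull // expn_gt0.
have low k : (4 ^ k <= al (3 ^ k.+1 * N1))%N.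
  elim: k => [|k IH].
    by have := big _ (N1k 0%N); rewrite mul1n expn1; apply: leq_ltn_trans.
  have := big _ (N1k k.+1); rewrite mulnA -expnS [(4 ^ k.+1)%N]expnS; move: IH; lia.
have low2 k : (4 ^ k <= 3 ^ k.+1 * N1)%N := leq_trans (low k) (h _).
(* Bernoulli's inequality for the powers of 4/3; at [k = 9 * N1] it contradicts [low2]. *)
have bern k : (3 ^ k * (3 + k) <= 3 * 4 ^ k)%N by elim: k => [|k IH] //; rewrite !expnS; move: (3 ^ k)%N (4 ^ k)%N IH => s t; clear; nia.
have := leq_trans (bern (9 * N1)%N) _; move=> /(_ (3 * (3 ^ (9 * N1).+1 * N1))%N).
rewrite leq_mul2l low2 => /(_ isT); rewrite expnS.
have : (0 < 3 ^ (9 * N1))%N by rewrite expn_gt0.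
by set T := (3 ^ _)%N; nia.
Qed.

(** * Gluing arms into long connections *)

Section Hop.
Context {R : realType}.
Local Notation pr := (@pr R).

(* The centre [u = (2N, h)] of a translate of the box of radius [N] is joined to
   the parts of the right side of that box above and below the segment where the
   path issued from the origin ends, so that path has to meet the cluster of [u]. *)
Lemma pr_hop_half (a : R) N al al3 : 0 < a -> (0 < N)%N -> (al <= N)%N -> (al3 <= 4 * al)%N ->
  a <= pr (fun w => conn w (inbox N) org (side N al)) ->
  a <= pr (fun w => conn w (inbox (3 * N)) org (seg (3 * N) 0 al3%:Z)) ->
  exists h : int, a / 2 * (a * a) <=
    pr (fun w => conn w (rect (- (3 * N%:Z)) (7 * N%:Z) (- (4 * N%:Z)) (4 * N%:Z))
      org (pred1 (2 * N%:Z, h))).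
Proof.
move=> a0 N0 hal hal3 hside hseg.
(* The windows of half-width [al] centred at [al] and [3 * al] cover the heights from 0 to [4 * al],
   hence the whole segment up to [al3]; one of them is hit with probability at least [a / 2]. *)
have [h [h0 hN hpiece]] : exists h : int, [/\ 0 <= h, h <= 3 * al%:Z & a / 2 <=
    pr (fun w => conn w (inbox (3 * N)) org (seg (3 * N) (h - al%:Z) (h + al%:Z)))].
  have := pr_conn_split (R := R) (3 * N) (inbox (3 * N)) org (seg (3 * N) 0 al3%:Z)
     (seg (3 * N) (al%:Z - al%:Z) (al%:Z + al%:Z))
     (seg (3 * N) (3 * al%:Z - al%:Z) (3 * al%:Z + al%:Z)) (fun _ => id).
  have [hle _|hgt] := leP (a / 2) (pr (fun w => conn w (inbox (3 * N)) org
     (seg (3 * N) (al%:Z - al%:Z) (al%:Z + al%:Z)))).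
    by exists al%:Z; split=> //; lia.
  move=> /(_ _) hsum; exists (3 * al%:Z); split; [clear; lia|clear; lia|].
  have : forall z, inbox (3 * N) z -> seg (3 * N) 0 al3%:Z z ->
      seg (3 * N) (al%:Z - al%:Z) (al%:Z + al%:Z) z
      || seg (3 * N) (3 * al%:Z - al%:Z) (3 * al%:Z + al%:Z) z.
    by move=> z _; rewrite /seg; clear -hal3; lia.
  move=> /hsum; lra.
exists h; set u := (2 * N%:Z, h).
pose U2 := rect (N%:Z) (3 * N%:Z) (h - N%:Z) (h + N%:Z).
pose S1 : pred Z2 := fun z => (z.1 == 3 * N%:Z) && (h + al%:Z <= z.2).
pose S2 : pred Z2 := fun z => (z.1 == 3 * N%:Z) && (z.2 <= h - al%:Z).
have [n hn] := rect_inbox (N%:Z) (3 * N%:Z) (h - N%:Z) (h + N%:Z).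
have su : shift u org = u by rewrite /shift /u /=; congr pair; lia.
have h1 : a <= pr (fun w => conn w U2 u S1).
  apply: le_trans hside _; rewrite -su.
  apply: (pr_conn_map _ _ N n) => //; first exact: shift_lattice.
  - by move=> z; rewrite /U2 /inbox /rect /shift /u /=; lia.
  - by move=> z _; rewrite /S1 /side /shift /u /=; lia.
have h2 : a <= pr (fun w => conn w U2 u S2).
  apply: le_trans hside _; have sv : (shift u \o refl_y) org = u by rewrite -[RHS]su.
  rewrite -sv; apply: (pr_conn_map _ _ N n) => //.
  - split; first by apply: inj_comp; [case: (shift_lattice u)|case: refl_y_lattice].
    by move=> b c hbc /=; case: (shift_lattice u) => _; apply; case: refl_y_lattice => _; apply.
  - by move=> z; rewrite /U2 /inbox /rect /shift /refl_y /u /=; lia.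
  - by move=> z _; rewrite /S2 /side /shift /refl_y /u /=; lia.
have d1 : fdep (fun w => conn w U2 u S1) := rect_fdep _ _ _ _ _ _.
have d2 : fdep (fun w => conn w U2 u S2) := rect_fdep _ _ _ _ _ _.
have d3 := inbox_fdep (3 * N) org (seg (3 * N) (h - al%:Z) (h + al%:Z)).
have i12 : incp (fun w => conn w U2 u S1 /\ conn w U2 u S2).
  by move=> w w' hw [c1 c2]; split; apply: conn_inc hw _.
have f1 := pr_FKG (R := R) _ _ d1 d2 (conn_inc _ _ _) (conn_inc _ _ _).
have f2 := pr_FKG (R := R) _ _ d3 (fdep_and _ _ d1 d2) (conn_inc _ _ _) i12.
apply: le_trans (le_trans _ f2) _.
  apply: ler_pM => //; [lra|by rewrite mulr_ge0 // ltW|].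
  by apply: le_trans f1; apply: ler_pM => //; apply: ltW.
apply: pr_le; [exact: fdep_and (fdep_and _ _ d1 d2)|exact: rect_fdep|].
move=> w [c1 [c2 c3]].
apply: (conn_glue w _ (inbox (3 * N)) U2 _ S1 S2 u org (3 * N%:Z) (h + al%:Z) (h - al%:Z) c1 c2 c3).
- by move=> z; rewrite /rect /inbox; lia.
- by move=> z; rewrite /rect /U2 /rect /=; lia.
- by move=> z _; rewrite /seg; lia.
- by move=> z _; rewrite /S1; lia.
- by move=> z _; rewrite /S2; lia.
Qed.

(** The reflection in the vertical line at [2 * N] fixes the point found by [pr_hop_half], preserves
    the rectangle and exchanges the origin with [(4 * N, 0)]. The two connections to the common
    point are positively correlated. *)
Lemma pr_hop (a : R) N al al3 : 0 < a -> (0 < N)%N -> (al <= N)%N -> (al3 <= 4 * al)%N ->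
  a <= pr (fun w => conn w (inbox N) org (side N al)) ->
  a <= pr (fun w => conn w (inbox (3 * N)) org (seg (3 * N) 0 al3%:Z)) ->
  (a / 2 * (a * a)) ^+ 2 <=
    pr (fun w => conn w (rect (- (3 * N%:Z)) (7 * N%:Z) (- (4 * N%:Z)) (4 * N%:Z))
      org (pred1 (4 * N%:Z, 0))).
Proof.
move=> a0 N0 hal hal3 hside hseg.
have [h hh] := pr_hop_half a N al al3 a0 N0 hal hal3 hside hseg.
set U := rect _ _ _ _ in hh *; set u := (_, h) in hh *; set c := _ * (_ * _) in hh *.
have c0 : 0 <= c by rewrite /c !mulr_ge0 ?invr_ge0 // ltW.
have [n hn] := rect_inbox (- (3 * N%:Z)) (7 * N%:Z) (- (4 * N%:Z)) (4 * N%:Z).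
have hh' : c <= pr (fun w => conn w U (4 * N%:Z, 0) (pred1 u)).
  apply: le_trans hh _.
  have -> : (4 * N%:Z, 0) = refl_x (4 * N%:Z) org :> Z2 by rewrite /refl_x /= subr0.
  apply: (pr_conn_map _ _ n n) => //; first exact: refl_x_lattice.
  - by move=> z; rewrite /U /rect /refl_x /=; lia.
  - move=> z _ /= /eqP ->; rewrite /u /refl_x /= xpair_eqE; lia.
have d x S : fdep (fun w => conn w U x S) := rect_fdep _ _ _ _ _ _.
have f := pr_FKG (R := R) _ _ (d org (pred1 u)) (d (4 * N%:Z, 0) (pred1 u)) (conn_inc _ _ _) (conn_inc _ _ _).
rewrite expr2; apply: le_trans (le_trans _ f) _; first exact: ler_pM.
apply: pr_le; [exact: fdep_and|exact: d|].
by move=> w [c1 /conn_sym]; exact: conn_trans.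
Qed.

(** Each further hop is a translate of the first, and positive correlation multiplies the bounds. *)
Lemma pr_chain (c : R) N k : 0 <= c ->
  c <= pr (fun w => conn w (rect (- (3 * N%:Z)) (7 * N%:Z) (- (4 * N%:Z)) (4 * N%:Z))
      org (pred1 (4 * N%:Z, 0))) ->
  c ^+ k.+1 <= pr (fun w => conn w
      (rect (- (3 * N%:Z)) ((4 * k%:Z + 7) * N%:Z) (- (4 * N%:Z)) (4 * N%:Z))
      org (pred1 (4 * k.+1%:Z * N%:Z, 0))).
Proof.
move=> c0 hc; elim: k => [|k IH]; first by rewrite expr1 mulr0 add0r mulr1.
set V := rect _ _ _ _ in IH *; set W := rect _ _ _ _.
set v := (_, 0) in IH *.
have [n hn] := rect_inbox (- (3 * N%:Z)) (7 * N%:Z) (- (4 * N%:Z)) (4 * N%:Z).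
have [m hm] := rect_inbox (- (3 * N%:Z)) ((4 * k.+1%:Z + 7) * N%:Z) (- (4 * N%:Z)) (4 * N%:Z).
have h : c <= pr (fun w => conn w W v (pred1 (4 * k.+2%:Z * N%:Z, 0))).
  apply: le_trans hc _; have {1}-> : v = shift v org by rewrite /shift /v /= !add0r.
  apply: (pr_conn_map _ _ n m) => //; first exact: shift_lattice.
  - by move=> z; rewrite /W /rect /shift /v /=; nia.
  - move=> z _ /= /eqP ->; rewrite /v /shift /= xpair_eqE; lia.
have f := pr_FKG (R := R) _ _ (rect_fdep _ _ _ _ org (pred1 v))
   (rect_fdep _ _ _ _ v (pred1 (4 * k.+2%:Z * N%:Z, 0))) (conn_inc V _ _) (conn_inc W _ _).
rewrite exprSr; apply: le_trans (le_trans _ f) _.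
  by apply: ler_pM => //; exact: exprn_ge0.
apply: pr_le; [exact: fdep_and (rect_fdep _ _ _ _ _ _) (rect_fdep _ _ _ _ _ _)|exact: rect_fdep|].
move=> w [c1 c2]; apply: conn_trans c2; apply: conn_sub c1 => // z.
by rewrite /V /W /rect; nia.
Qed.
End Hop.

(** * Dual barriers in annuli *)

(* A connection between faces, crossing the annulus above the inner box; [w] is
   here a configuration of dual edges transported to the lattice edges they cross. *)
Definition top_dual (N : nat) (w : config) : Prop :=
  conn (w \o dl) (rect (- (15 * N%:Z)) (15 * N%:Z) (2 * N%:Z) (10 * N%:Z))
    (- (12 * N%:Z), 6 * N%:Z) (pred1 (12 * N%:Z, 6 * N%:Z)).

(** Dual crossings above, below, right and left of the inner box. Each is longer than the box of
    radius [11 * N] is wide and blocks one side of it by itself; they are not joined into a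
    circuit. *)
Definition dual_barrier (N : nat) (w : config) : Prop :=
  top_dual N w /\ (top_dual N (w \o emap refl_y) /\
  (top_dual N (w \o emap swap) /\ top_dual N (w \o emap antiswap))).

Definition flip (w : config) : config := fun e => ~~ w e.

Lemma top_dual_blocks N w : (0 < N)%N -> top_dual N (flip w) ->
  ~ conn w (inbox (11 * N)) org (fun z => z.2 == (11 * N)%N%:Z).
Proof.
move=> N0 [D [d1 d2 d3 /eqP d4]] [Q [q1 q2 q3 /eqP q4]].
apply: (dual_block w org Q _ D (2 * N%:Z) (10 * N%:Z) q1 q2 d1 d2) => //.
- by rewrite q4; clear -N0; lia.
- by move=> z /(allP q3); rewrite d4 /inbox /=; clear -N0; lia.
- by move=> z /(allP d3); rewrite /rect => /andP[].
Qed.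

Lemma emap_involutive s : lattice_map s -> involutive s -> involutive (emap s).
Proof.
move=> hs si e; rewrite {2}/emap emap_edge //; last by case: hs => _; apply; exact: adjb_ends.
by rewrite !si edge_of_src_dst.
Qed.

Lemma conn_involution s w (U : pred Z2) x (S S' : pred Z2) : lattice_map s -> involutive s ->
  (forall z, U z -> U (s z)) -> (forall z, U z -> S z -> S' (s z)) ->
  conn w U x S -> conn (w \o emap s) U (s x) S'.
Proof.
move=> hs si hU hS h; apply: (conn_emap s _ U x S) => //.
by apply: conn_sub h => // e we /=; rewrite (emap_involutive s hs si).
Qed.

Lemma dual_barrier_blocks N w : (0 < N)%N -> dual_barrier N (flip w) ->
  ~ conn w (inbox (11 * N)) org (bdry (11 * N)).
Proof.
move=> N0 [h1 [h2 [h3 h4]]] h.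
have key s (S : pred Z2) : lattice_map s -> involutive s -> s org = org ->
    (forall z, inbox (11 * N) z -> inbox (11 * N) (s z)) ->
    (forall z, inbox (11 * N) z -> S z -> (s z).2 == (11 * N)%N%:Z) ->
    top_dual N (flip w \o emap s) -> ~ conn w (inbox (11 * N)) org S.
  move=> hs si so hU hS ht hc; apply: (top_dual_blocks N (w \o emap s) N0 ht).
  by rewrite -so; apply: conn_involution hc.
have : conn w (inbox (11 * N)) org (fun z => z.2 == (11 * N)%N%:Z) \/
  (conn w (inbox (11 * N)) org (fun z => z.2 == - (11 * N)%N%:Z) \/
  (conn w (inbox (11 * N)) org (fun z => z.1 == (11 * N)%N%:Z) \/
   conn w (inbox (11 * N)) org (fun z => z.1 == - (11 * N)%N%:Z))).
  case: h => p [p1 p2 p3]; rewrite /bdry => p4.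
  have [e|[e|[e|e]]] : (last org p).2 == (11 * N)%N%:Z \/ (last org p).2 == - (11 * N)%N%:Z
      \/ (last org p).1 == (11 * N)%N%:Z \/ (last org p).1 == - (11 * N)%N%:Z.
    by move: p4; case: (last _ p) => a b /=; clear; lia.
  - by left; exists p.
  - by right; left; exists p.
  - by right; right; left; exists p.
  - by right; right; right; exists p.
case; [|case; [|case]].
- exact: top_dual_blocks.
- apply: (key refl_y) => //.
  + exact: refl_y_lattice.
  + by case=> a b; rewrite /refl_y /= opprK.
  + by move=> z; rewrite /inbox /refl_y /=; clear; lia.
  + by move=> z _ /eqP; rewrite /refl_y /= => ->; rewrite opprK.
- apply: (key swap) => //.
  + exact: swap_lattice.
  + by case.
  + by move=> z; rewrite /inbox /swap /=; clear; lia.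
- apply: (key antiswap) => //.
  + exact: antiswap_lattice.
  + by case=> a b; rewrite /antiswap /= !opprK.
  + by move=> z; rewrite /inbox /antiswap /=; clear; lia.
  + by move=> z _ /eqP; rewrite /antiswap /= => ->; rewrite opprK.
Qed.

Definition inner (N : nat) : pred Edge := fun e => inbox N (src e) && inbox N (dst e).

Lemma inner_edge_of N a b : adjb a b -> inner N (edge_of a b) = inbox N a && inbox N b.
Proof. by move=> /edge_of_ends [] -[h1 h2]; rewrite /inner -h1 -h2 // andbC. Qed.

Lemma inner_emap N s e : lattice_map s -> involutive s ->
  (forall z, inbox N z -> inbox N (s z)) -> inner N (emap s e) = inner N e.
Proof.
move=> hs si h; have h' z : inbox N (s z) = inbox N z.
  by apply/idP/idP => [/h|/h //]; rewrite si.
rewrite /emap inner_edge_of ?h' //; case: hs => _; apply; exact: adjb_ends.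
Qed.

(** The faces involved have height at least [2 * N], so no edge inside the box of radius [N] is
    crossed. *)
Lemma top_dual_dep N : (0 < N)%N -> depf (top_dual N) (predC (inner N)).
Proof.
move=> N0; suff H w w' : (forall e, (predC (inner N)) e -> w e = w' e) -> top_dual N w -> top_dual N w'.
  by move=> w w' h; apply/propext; split; apply: H => // e /h ->.
move=> h [p [p1 p2 p3 p4]]; exists p; split=> //; apply/allP => e he /=.
rewrite -h; first exact: (allP p2).
have [/(allP p3) k1 /(allP p3) k2] := edges_mem _ _ _ p1 he.
move: k1 k2; rewrite /= /inner /rect /inbox /dl /src /dst.
by case: e {he} => [[a b] []] /=; clear -N0; lia.
Qed.

Lemma depf_comp_inner (X : Type) N s (A : config -> X) : lattice_map s -> involutive s ->
  (forall z, inbox N z -> inbox N (s z)) -> depf A (predC (inner N)) ->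
  depf (fun w => A (w \o emap s)) (predC (inner N)).
Proof.
move=> hs si hN hA w w' h; apply: hA => e he; apply: h => /=.
by rewrite inner_emap.
Qed.

Lemma dual_barrier_dep N : (0 < N)%N -> depf (fun w => ~ dual_barrier N (flip w)) (predC (inner N)).
Proof.
move=> N0 w w' h; congr (~ _); have hf e : predC (inner N) e -> flip w e = flip w' e.
  by move=> /h; rewrite /flip => ->.
have t := top_dual_dep N N0; rewrite /dual_barrier.
rewrite (t _ _ hf); congr (_ /\ (_ /\ (_ /\ _))).
- apply: (depf_comp_inner _ N refl_y) => //; first exact: refl_y_lattice.
  + by case=> a b; rewrite /refl_y /= opprK.
  + by move=> z; rewrite /inbox /refl_y /=; clear; lia.
- apply: (depf_comp_inner _ N swap) => //; first exact: swap_lattice.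
  + by case.
  + by move=> z; rewrite /inbox /swap /=; clear; lia.
- apply: (depf_comp_inner _ N antiswap) => //; first exact: antiswap_lattice.
  + by case=> a b; rewrite /antiswap /= !opprK.
  + by move=> z; rewrite /inbox /antiswap /=; clear; lia.
Qed.

(** * Decay of the one-arm probability *)

Section Harris.
Context {R : realType}.
Local Notation pr := (@pr R).

Lemma top_dual_inc N : incp (top_dual N).
Proof. by move=> w w' h; apply: conn_sub => // e; exact: h. Qed.

Lemma top_dual_fdep N : fdep (top_dual N).
Proof. exact: (fdep_comp dl _ (rect_fdep _ _ _ _ _ _)). Qed.

(** The four crossings are increasing events of equal probability, hence positively correlated. *)
Lemma pr_dual_barrier (c : R) N : 0 <= c -> c <= pr (top_dual N) ->
  c ^+ 4 <= pr (dual_barrier N).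
Proof.
move=> c0 hc; pose T s w := top_dual N (w \o emap s).
have fT s : fdep (T s) by apply: (fdep_comp (emap s) _ (top_dual_fdep N)).
have iT s : incp (T s) by move=> w w' h; apply: top_dual_inc => e; exact: h.
have hT s : lattice_map s -> c <= pr (T s).
  by move=> hs; rewrite /T pr_comp //; [exact: emap_inj|exact: top_dual_fdep].
have mul (A B : config -> Prop) (a b : R) : 0 <= a -> 0 <= b -> fdep A -> fdep B -> incp A -> incp B ->
    a <= pr A -> b <= pr B -> a * b <= pr (fun w => A w /\ B w).
  by move=> a0 b0 fA fB iA iB hA hB; apply: le_trans (pr_FKG _ _ fA fB iA iB); exact: ler_pM.
have iand (A B : config -> Prop) : incp A -> incp B -> incp (fun w => A w /\ B w).
  by move=> iA iB w w' h [/(iA _ _ h) ? /(iB _ _ h) ?].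
rewrite exprS exprS expr2; apply: (mul (top_dual N)) => //; rewrite ?mulr_ge0 //.
- exact: top_dual_fdep.
- exact: fdep_and (fT _) (fdep_and _ _ (fT _) (fT _)).
- exact: top_dual_inc.
- exact: iand (iT _) (iand _ _ (iT _) (iT _)).
apply: (mul (T refl_y) (fun w => T swap w /\ T antiswap w)) => //; rewrite ?mulr_ge0 //.
- exact: fdep_and (fT _) (fT _).
- exact: iand (iT _) (iT _).
- exact: hT refl_y_lattice.
apply: (mul (T swap) (T antiswap)) => //; apply: hT.
- exact: swap_lattice.
- exact: antiswap_lattice.
Qed.

(** An arm to radius [11 * N] contains an arm to radius [N] and excludes a barrier of closed edges.
    These two conditions depend on disjoint sets of edges, and a closed barrier is as likely as an
    open one. *)
Lemma theta_step (c : R) N : 0 <= c -> (0 < N)%N ->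
  c <= pr (fun w => conn w (rect (- (3 * N%:Z)) (7 * N%:Z) (- (4 * N%:Z)) (4 * N%:Z))
      org (pred1 (4 * N%:Z, 0))) ->
  theta (11 * N) <= theta N * (1 - (c ^+ 6) ^+ 4) :> R.
Proof.
(* Six hops of length [4 * N] span the distance [24 * N] between the ends of [top_dual], whose
   rectangle is a translate of the one in [pr_chain]. *)
move=> c0 N0 hc; have h6 := pr_chain c N 5 c0 hc.
have ht : c ^+ 6 <= pr (top_dual N).
  (* Self-duality: the coins read through [dl] are again fair and independent. *)
  have -> : pr (top_dual N) = pr (fun w => conn w
      (rect (- (15 * N%:Z)) (15 * N%:Z) (2 * N%:Z) (10 * N%:Z))
      (- (12 * N%:Z), 6 * N%:Z) (pred1 (12 * N%:Z, 6 * N%:Z))).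
    apply: (pr_comp dl _ (can_inj dlK)); exact: rect_fdep.
  apply: le_trans h6 _.
  have {1}-> : (- (12 * N%:Z), 6 * N%:Z) = shift (- (12 * N%:Z), 6 * N%:Z) org.
    by rewrite /shift /= !add0r.
  have [n hn] := rect_inbox (- (3 * N%:Z)) ((4 * 5%:Z + 7) * N%:Z) (- (4 * N%:Z)) (4 * N%:Z).
  have [m hm] := rect_inbox (- (15 * N%:Z)) (15 * N%:Z) (2 * N%:Z) (10 * N%:Z).
  apply: (pr_conn_map _ _ n m) => //; first exact: shift_lattice.
  - by move=> z; rewrite /rect /shift /=; clear; lia.
  - by move=> z _ /= /eqP ->; rewrite /shift /= xpair_eqE; clear; lia.
have hD := pr_dual_barrier _ N (exprn_ge0 6 c0) ht.
have fT s : fdep (fun w => top_dual N (w \o emap s)) := fdep_comp (emap s) _ (top_dual_fdep N).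
have fD : fdep (dual_barrier N) := fdep_and _ _ (top_dual_fdep N) (fdep_and _ _ (fT _) (fdep_and _ _ (fT _) (fT _))).
have fD' : fdep (fun w => dual_barrier N (flip w)) := fdep_flip _ fD.
have -> : theta (11 * N) = pr (fun w => conn w (inbox (11 * N)) org (bdry (11 * N))) by [].
pose B w := conn w (inbox N) org (bdry N) /\ ~ dual_barrier N (flip w).
apply: (@le_trans _ _ (pr B)).
  apply: pr_le; [exact: inbox_fdep|exact: fdep_and (inbox_fdep _ _ _) (fdep_not _ fD')|].
  move=> w h; split; last by move=> /(dual_barrier_blocks N w N0).
  have sh z : shift org z = z by case: z => a b; rewrite /shift /= !addr0.
  have h' : conn w (fun z => inbox (11 * N) (shift org z)) org (fun z => bdry (11 * N) (shift org z)).
    by apply: conn_sub h => // z; rewrite sh.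
  have := conn_exit w (11 * N) N org org _ _ h'.
  rewrite leq_pmull // sh => /(_ isT isT); apply: conn_sub => // z; by rewrite sh.
rewrite (pr_indep _ _ (inner N) (inbox_fdep _ _ _) (fdep_not _ fD')); last exact: dual_barrier_dep.
  rewrite pr_not // (pr_flip _ fD).
  by rewrite ler_wpM2l ?pr_ge0 // lerB.
exact: conn_dep.
Qed.

(* Harris' theorem: no percolation at density 1/2. *)
Lemma theta_small (d : R) : 0 < d -> exists N, theta N < d.
Proof.
move=> d0; apply: contrapT => hno.
have hd N : d <= theta N by rewrite leNgt; apply/negP => h; apply: hno; exists N.
(* [theta_side] costs a factor 8 and [alpha_exists] a further factor 2. *)
pose a := d / 16; have a0 : 0 < a by rewrite /a divr_gt0.
have /choice [al hal] : forall N, exists al : nat,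
    [/\ (al <= N)%N, a <= pr (fun w => conn w (inbox N) org (side N al))
      & a <= pr (fun w => conn w (inbox N) org (seg N 0 al%:Z))].
  move=> N; apply: alpha_exists => //; apply: le_trans (hd N); rewrite /a; lra.
(* The square comes from the two halves of a hop, the sixth power from the chain of hops, the fourth
   from the sides of the barrier. *)
pose c := ((a / 2 * (a * a)) ^+ 2 ^+ 6) ^+ 4.
have c0 : 0 < c by rewrite /c !exprn_gt0 // !mulr_gt0 // invr_gt0.
have decay N0 : exists N, (N0 <= N)%N /\ theta (11 * N) <= theta N * (1 - c).
  have [|N [hN N1 h4]] := subgeometric_step al N0; first by move=> N; case: (hal N).
  exists N; split=> //; apply: theta_step => //; first exact: sqr_ge0.
  have [h1 h2 _] := hal N; have [h3 _ h5] := hal (3 * N)%N.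
  exact: (pr_hop a N (al N) (al (3 * N)%N)).
have mono M N : (N <= M)%N -> theta M <= theta N :> R.
  move=> NM; apply: pr_le; [exact: inbox_fdep..|] => w h.
  have sh z : shift org z = z by case: z => x y; rewrite /shift /= !addr0.
  have h' : conn w (fun z => inbox M (shift org z)) org (fun z => bdry M (shift org z)).
    by apply: conn_sub h => // z; rewrite sh.
  have := conn_exit w M N org org NM _ h'.
  rewrite sh => /(_ isT); apply: conn_sub => // z; by rewrite sh.
(* Otherwise some one-arm probability would be at most 0, against the lower bound [d]. *)
have c1 : c <= 1.
  have [N [_ h]] := decay 0%N.
  have := le_trans (hd _) h; rewrite leNgt; apply: contraNle => c1.
  apply: le_lt_trans d0; rewrite mulr_ge0_le0 ?pr_ge0 //; lra.
have pow k : exists N, theta N <= (1 - c) ^+ k.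
  elim: k => [|k [N IH]]; first by exists 0%N; rewrite expr0 pr_le1.
  have [M [NM hM]] := decay N; exists (11 * M)%N; apply: le_trans hM _.
  rewrite exprSr ler_wpM2r //; first lra.
  exact: le_trans (mono _ _ NM) IH.
have lim : (1 - c) ^+ n @[n --> \oo] --> (0 : R).
  by apply: cvg_expr; rewrite ger0_norm; lra.
have [k hk] : exists k, (1 - c) ^+ k < d.
  have : \forall n \near \oo, (1 - c) ^+ n < d.
    by apply: (cvgr_lt (0 : R)) lim _ d0.
  by move=> [k _ hk]; exists k; apply: (hk k) => /=.
have [N hN] := pow k; have := hd N; lra.
Qed.
End Harris.

(** * Domination of independent edge events by fair coins *)

Fixpoint mix (J : seq Edge) (c w : config) : config :=
  if J is e :: J' then mix J' c (upd w e (c e)) else w.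

Lemma mixE J c w e : mix J c w e = if e \in J then c e else w e.
Proof.
elim: J w => [|e' J IH] w //=; rewrite IH inE /upd.
by case: eqP => [->|//] /=; case: ifP.
Qed.

Section Domination.
Context {d : measure_display} {T : measurableType d} {R : realType}.
Variables (P : probability T R) (S : set Edge) (X : Edge -> T -> R) (B : set R).
Hypothesis X_meas : forall e, S e -> measurable_fun setT (X e).
Hypothesis X_indep : mutually_independent P S X.
Hypothesis B_meas : measurable B.
Hypothesis B_half : forall e, S e -> (P (X e @^-1` B) <= (2^-1)%:E)%E.

(** Edges outside [S] count as closed. *)
Definition state (t : T) : config := fun e => `[< S e /\ B (X e t) >].

Let m (A : set T) : R := fine (P A).

Let mE A : measurable A -> P A = (m A)%:E.
Proof. by move=> mA; rewrite /m fineK // fin_num_measure. Qed.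

Let m_ge0 A : 0 <= m A.
Proof. exact: fine_ge0. Qed.

Let m_le A A' : measurable A -> measurable A' -> A `<=` A' -> m A <= m A'.
Proof.
by move=> mA mA' h; rewrite -lee_fin -!mE //; apply: le_measure; rewrite ?inE.
Qed.

Let m_split A W : measurable A -> measurable W -> m A = m (A `&` W) + m (A `&` ~` W).
Proof.
move=> mA mW; have h1 : measurable (A `&` W) by apply: measurableI.
have h2 : measurable (A `&` ~` W) by apply: measurableI => //; exact: measurableC.
apply: EFin_inj; rewrite EFinD -!mE // -measureU //; last by rewrite setIACA setICr setI0.
by rewrite -setIUr setUCr setIT.
Qed.

Let cyl (s : seq Edge) (C : Edge -> set R) : set T := \big[setI/setT]_(e <- s) (X e @^-1` C e).

Let X_pre e C : S e -> measurable C -> measurable (X e @^-1` C).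
Proof. by move=> Se mC; rewrite -[_ @^-1` _]setTI; apply: X_meas. Qed.

Let cyl_meas (s : seq Edge) C : (forall e, e \in s -> S e) -> (forall e, measurable (C e)) -> measurable (cyl s C).
Proof.
move=> hs hC; rewrite /cyl big_seq; elim/big_ind: _ => [||e /hs Se].
- exact: measurableT.
- by move=> *; apply: measurableI.
- exact: X_pre.
Qed.

Let cyl_cons (s : seq Edge) C (e : Edge) D : e \notin s ->
  cyl (e :: s) (fun i => if i == e then D else C i) = (X e @^-1` D) `&` cyl s C.
Proof.
move=> es; rewrite /cyl big_cons eqxx; congr (_ `&` _).
rewrite !big_seq; apply: eq_bigr => i si.
by case: eqP => // ie; move: es; rewrite -ie si.
Qed.

Let m_cyl_cons (s : seq Edge) C (e : Edge) D : uniq s -> (forall i, i \in s -> S i) -> (forall i, measurable (C i)) ->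
  S e -> e \notin s -> measurable D ->
  m (cyl s C `&` X e @^-1` D) = m (cyl s C) * m (X e @^-1` D).
Proof.
move=> us hs hC Se es mD; rewrite setIC -cyl_cons //.
set C' := fun i => _.
have hC' i : measurable (C' i) by rewrite /C'; case: eqP.
have hs' i : i \in e :: s -> S i by rewrite inE => /orP[/eqP ->|/hs].
have us' : uniq (e :: s) by rewrite /= es.
have h1 : P (cyl (e :: s) C') = (P (X e @^-1` D) * P (cyl s C))%E.
  rewrite /cyl (X_indep _ _ us' hs' hC') big_cons (X_indep _ _ us hs hC) {1}/C' eqxx.
  congr (_ * _)%E; rewrite !big_seq; apply: eq_bigr => i si.
  by rewrite /C'; case: eqP => // ie; move: es; rewrite -ie si.
apply: EFin_inj; rewrite EFinM -!mE ?h1; [by rewrite muleC|exact: X_pre|exact: cyl_meas|exact: cyl_meas].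
Qed.

Let ev (J : seq Edge) (A : config -> Prop) (w : config) : set T :=
  [set t | A (mix J (state t) w)].

Let ev_cons e J A w : ev (e :: J) A w =
  if `[< S e >] then ((X e @^-1` B) `&` ev J A (upd w e true)) `|`
      (~` (X e @^-1` B) `&` ev J A (upd w e false))
  else ev J A (upd w e false).
Proof.
rewrite /ev /state; case: asboolP => Se; apply/seteqP; split => t /=.
- have [Bt|nBt] := pselect (B (X e t)).
    by rewrite (asboolT (conj Se Bt)); left.
  by rewrite (asboolF (P := S e /\ _)); [right|case].
- by move=> [[Bt]|[nBt]]; [rewrite (asboolT (conj Se Bt))|rewrite (asboolF (P := S e /\ _)) // => -[]].
- by rewrite (asboolF (P := S e /\ _)) // => -[].
- by rewrite (asboolF (P := S e /\ _)) // => -[].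
Qed.

Let ev_meas J A w : measurable (ev J A w).
Proof.
elim: J w => [|e J IH] w.
  rewrite /ev /=; have [h|h] := pselect (A w).
    by rewrite (_ : [set _ | _] = setT) //; apply/seteqP; split.
  by rewrite (_ : [set _ | _] = set0) //; apply/seteqP; split.
rewrite ev_cons; case: asboolP => // Se.
by apply: measurableU; apply: measurableI => //; [exact: X_pre|apply: measurableC; exact: X_pre].
Qed.

(** The edges of [J] are revealed one at a time, [cyl s C] recording those already revealed. An edge
    is open with probability [p <= 1/2], and [p E1 + (1 - p) E0 <= (E1 + E0) / 2] because [E0 <= E1]
    for an increasing event. *)
Let ev_bound J A w (s : seq Edge) C : uniq J -> uniq s -> (forall e, e \in s -> S e) ->
  (forall e, e \in s -> e \notin J) -> (forall e, measurable (C e)) -> incp A ->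
  m (cyl s C `&` ev J A w) <= m (cyl s C) * expect J (ind A) w.
Proof.
move=> + + + + + iA; elim: J w s C => [|e J IH] w s C /=.
  move=> _ us hs _ hC; rewrite /ev /= /ind; case: asboolP => h.
    rewrite mulr1; apply: m_le; [apply: measurableI; [exact: cyl_meas|exact: (ev_meas [::])]|exact: cyl_meas|exact: subIsetl].
  rewrite mulr0 (_ : _ `&` _ = set0) ?/m ?measure0 //.
  by apply/seteqP; split => // t [].
move=> /andP[eJ uJ] us hs hsJ hC.
have hs' i : i \in s -> i \notin J by move=> /hsJ; rewrite inE negb_or => /andP[].
have es : e \notin s by apply/negP => /hsJ; rewrite mem_head.
have mono : expect J (ind A) (upd w e false) <= expect J (ind A) (upd w e true) :> R.
  by apply: expect_inc; [exact: ind_inc|exact: upd_lec].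
rewrite ev_cons; case: asboolP => Se; last first.
  apply: le_trans (IH _ s C uJ us hs hs' hC) _; rewrite ler_wpM2l //; lra.
set W := X e @^-1` B; have mW : measurable W by apply: X_pre.
have mc : measurable (cyl s C) by exact: cyl_meas.
set E1 := expect J _ (upd w e true) in mono *; set E0 := expect J _ _ in mono *.
have step D (b : bool) : measurable D ->
   m (cyl s C `&` X e @^-1` D `&` ev J A (upd w e b)) <=
   m (cyl s C) * m (X e @^-1` D) * expect J (ind A) (upd w e b).
  move=> mD; rewrite -m_cyl_cons //.
  have -> : cyl s C `&` X e @^-1` D = cyl (e :: s) (fun i => if i == e then D else C i).
    by rewrite cyl_cons // setIC.
  apply: IH => //=; first by rewrite es.
  - by move=> i; rewrite inE => /orP[/eqP ->|/hs].
  - by move=> i; rewrite inE => /orP[/eqP ->|/hs'].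
  - by move=> i; case: eqP.
have sB := step B true B_meas.
have sC := step (~` B) false (measurableC B_meas).
have mT : m [set: T] = 1 by rewrite /m probability_setT.
have mW1 : m W + m (~` W) = 1 by rewrite -mT (m_split [set: T] W) // !setTI.
have hW : m W <= 2^-1 by rewrite -lee_fin -mE //; exact: B_half.
rewrite (_ : cyl s C `&` _ = (cyl s C `&` W `&` ev J A (upd w e true)) `|`
    (cyl s C `&` ~` W `&` ev J A (upd w e false))); last by rewrite setIUr !setIA.
have mA1 : measurable (cyl s C `&` W `&` ev J A (upd w e true)).
  by apply: measurableI => //; exact: measurableI.
have mA0 : measurable (cyl s C `&` ~` W `&` ev J A (upd w e false)).
  by apply: measurableI => //; apply: measurableI => //; exact: measurableC.
have -> : m ((cyl s C `&` W `&` ev J A (upd w e true)) `|`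
    (cyl s C `&` ~` W `&` ev J A (upd w e false))) =
    m (cyl s C `&` W `&` ev J A (upd w e true)) + m (cyl s C `&` ~` W `&` ev J A (upd w e false)).
  apply: EFin_inj; rewrite EFinD -!mE //; last exact: measurableU.
  rewrite measureU //; apply/seteqP; split => // t /= [[[_ h] _] [[_ h'] _]] //.
apply: le_trans (lerD sB sC) _; rewrite -/W -/E1 -/E0.
rewrite (_ : m (X e @^-1` (~` B)) = 1 - m W); last by rewrite -mW1 [m W + _]addrC addrK.
have c0 := m_ge0 (cyl s C).
have : 0 <= (2^-1 - m W) * (E1 - E0) by rewrite mulr_ge0 // subr_ge0.
move=> h; have := mulr_ge0 c0 h; nra.
Qed.

Lemma state_dominated A : fdep A -> incp A ->
  measurable [set t | A (state t)] /\ (P [set t | A (state t)] <= (pr A)%:E)%E.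
Proof.
move=> [n hA] iA; have e : [set t | A (state t)] = ev (boxE n) A (fun=> false).
  apply/seteqP; split=> t /=; rewrite (hA (state t) (mix (boxE n) (state t) (fun=> false))) //;
  by move=> i hi; rewrite mixE mem_boxE ifT.
rewrite e; split=> //; rewrite (prE n) // mE // lee_fin.
have := ev_bound (boxE n) A (fun=> false) [::] (fun=> setT) (uniq_boxE n) isT.
rewrite /cyl big_nil setTI {2}/m probability_setT mul1r; apply=> //.
Qed.

Definition boxc (N : nat) (x : Z2) : pred Z2 := fun z => inbox N (shift (- x.1, - x.2) z).
Definition bdryc (N : nat) (x : Z2) : pred Z2 := fun z => bdry N (shift (- x.1, - x.2) z).

(** A cluster of [x] reaching every distance has probability at most [theta N] for all [N], hence
    zero by [theta_small], and there are countably many [x]. *)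
Lemma ae_finite_clusters :
  {ae P, forall t, forall x, exists N, ~ conn (state t) (boxc N x) x (bdryc N x)}.
Proof.
pose Q x t := exists N, ~ conn (state t) (boxc N x) x (bdryc N x).
have key x : {ae P, forall t, Q x t}.
  pose A N w := conn w (boxc N x) x (bdryc N x).
  have boxn N : exists n, forall z, boxc N x z -> inbox n z.
    exists (N + absz x.1 + absz x.2)%N => z; rewrite /boxc /inbox /shift /=; lia.
  have fA N : fdep (A N) by have [n hn] := boxn N; exact: (conn_fdep _ _ _ n).
  have iA N : incp (A N) by exact: conn_inc.
  have prA N : pr (A N) <= theta N :> R.
    have [n hn] := boxn N; have -> : theta N = pr (fun w => conn w (inbox N) org (bdry N)) :> R by [].
    have -> : org = shift (- x.1, - x.2) x by rewrite /shift /= !subrr.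
    by apply: (pr_conn_map _ _ n N) => //; exact: shift_lattice.
  exists (\bigcap_N [set t | A N (state t)]); split.
  - by apply: bigcapT_measurable => N; case: (state_dominated (A N)).
  - apply/eqP; rewrite eq_le measure_ge0 andbT.
    apply/lee_addgt0Pr => e e0; rewrite add0e.
    have [N hN] := theta_small e e0; have [mA hA] := state_dominated (A N) (fA N) (iA N).
    apply: le_trans (le_trans _ hA) _.
      apply: le_measure; rewrite ?inE //; last exact: bigcap_inf.
      by apply: bigcapT_measurable => M; case: (state_dominated (A M)).
    by rewrite lee_fin; apply: le_trans (prA N) (ltW hN).
  - move=> t /= h N _; apply: contrapT => hn; apply: h; by exists N.
(* [unpickle] enumerates the vertices; an integer coding no vertex gets a trivial statement. *)
have : {ae P, forall t, forall n : nat, if unpickle n is Some x then Q x t else True}.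
  by apply: ae_foralln => n; case: unpickle => [x|]; [exact: key|apply: aeW].
by apply: filterS => t h x; have := h (pickle x); rewrite pickleK.
Qed.

End Domination.

(** * Existence of geodesics by reduction to finitely many paths *)

Fixpoint short_seqs (U : Type) (K : seq U) (n : nat) : seq (seq U) :=
  if n is n'.+1 then [::] :: [seq a :: l | a <- K, l <- short_seqs U K n'] else [:: [::]].

Lemma mem_short_seqs (U : eqType) (K : seq U) n p :
  (size p <= n)%N -> {subset p <= K} -> p \in short_seqs U K n.
Proof.
elim: n p => [|n IH] [|a p] //= hs hK; rewrite inE /=.
apply: allpairs_f; first by apply: hK; rewrite mem_head.
by apply: IH => // t ht; apply: hK; rewrite inE ht orbT.
Qed.

Lemma seq_argmin (R : realType) (U : eqType) (L : seq U) (Q : U -> Prop) (f : U -> R) a :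
  a \in L -> Q a -> exists b, [/\ Q b & forall c, c \in L -> Q c -> f b <= f c].
Proof.
elim: L a => [|l L IH] a //; rewrite inE => hal Qa.
have [[a' a'L Qa']|no] := pselect (exists2 a', a' \in L & Q a').
  have [b [Qb hb]] := IH a' a'L Qa'.
  have [Ql|nQl] := pselect (Q l); last first.
    by exists b; split=> // c; rewrite inE => /orP[/eqP ->|/hb].
  have [h|h] := leP (f b) (f l).
    by exists b; split=> // c; rewrite inE => /orP[/eqP ->|/hb].
  exists l; split=> // c; rewrite inE => /orP[/eqP -> //|cL Qc].
  exact: le_trans (ltW h) (hb _ cL Qc).
exists a; split=> // c; rewrite inE => /orP[/eqP ->|cL Qc]; last by case: no; exists c.
move: hal => /orP[/eqP -> //|aL]; by case: no; exists a.
Qed.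

Section Geodesics.
Context {R : realType}.
Variables (V : set Z2) (w : Edge -> R).
Hypothesis w_ge0 : forall e, edges_in V e -> 0 <= w e.

(** Only finitely many simple paths lie in [K]. A cheapest one is cheapest overall, since a path
    costlier than [p0] is beaten by the reduction of [p0]. *)
Lemma geodesic_of_finite x y (K : seq Z2) p0 : is_path V x p0 y ->
  (forall p, is_path V x p y -> ptime w x p <= ptime w x p0 ->
    exists q, [/\ is_path V x q y, {subset x :: q <= K}, uniq (x :: q) &
      ptime w x q <= ptime w x p]) ->
  exists p, geodesic V w x p y.
Proof.
move=> hp0 hred; pose L := short_seqs Z2 K (size K).
have inL q : {subset x :: q <= K} -> uniq (x :: q) -> q \in L.
  move=> hq uq; apply: mem_short_seqs; last by move=> t tq; apply: hq; rewrite inE tq orbT.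
  by apply: ltnW; exact: uniq_leq_size uq hq.
have [q0 [q1 q2 q3 q4]] := hred _ hp0 (lexx _).
have [b [Qb hb]] := seq_argmin R _ L (fun q => is_path V x q y) (ptime w x) _ (inL _ q2 q3) q1.
have bmin p : is_path V x p y -> ptime w x b <= ptime w x p.
  move=> hp; have [/(hred _ hp) [q [k1 k2 k3 k4]]|h] := leP (ptime w x p) (ptime w x p0).
    exact: le_trans (hb _ (inL _ k2 k3) k1) k4.
  apply: le_trans (ltW h); apply: le_trans q4; apply: hb => //; exact: inL.
exists b; split=> //; rewrite /tau; apply/eqP; rewrite eq_le; apply/andP; split.
  by apply: lb_le_inf; [exists (ptime w x b); exists b|move=> _ [p hp <-]; exact: bmin].
by apply: ge_inf; [exists (ptime w x b) => _ [p hp <-]; exact: bmin|exists b].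
Qed.

Lemma edges_in_path x p y e : is_path V x p y -> e \in edges x p -> edges_in V e.
Proof. by move=> /is_pathP [h1 _ h3] /(edges_mem _ _ _ h1) [/h3 ? /h3 ?]. Qed.

Lemma sum_subseq_le (s1 s2 : seq Edge) : uniq s1 -> (forall e, e \in s2 -> 0 <= w e) ->
  (forall e, e \in s1 -> e \in s2 \/ w e = 0) ->
  \sum_(e <- s1) w e <= \sum_(e <- s2) w e.
Proof.
elim: s1 s2 => [|a s1 IH] s2 /=.
  by move=> _ h _; rewrite big_nil big_seq sumr_ge0.
move=> /andP[as1 us1] h0 hs; rewrite big_cons.
have [as2|as2] := boolP (a \in s2); last first.
  case: (hs a (mem_head _ _)) => [h|->]; first by rewrite h in as2.
  by rewrite add0r; apply: IH => // e es; apply: hs; rewrite inE es orbT.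
rewrite (perm_big _ (perm_to_rem as2)) big_cons lerD2l; apply: IH => //.
  by move=> e /mem_rem /h0.
move=> e es; case: (hs e); [by rewrite inE es orbT| |by right].
move=> es2; left; have : e \in a :: rem a s2 by rewrite -(perm_mem (perm_to_rem as2)).
by rewrite inE => /orP[/eqP ea|//]; move: as1; rewrite -ea es.
Qed.

Lemma uniq_edges x p : path adjb x p -> uniq (x :: p) -> uniq (edges x p).
Proof.
elim: p x => [|z p IH] x //= /andP[a hp] /andP[hx /andP[hz up]].
rewrite IH //= ?hz // andbT; apply/negP => /(edges_mem _ _ _ hp) [h1 h2].
move/negP: hx; apply; case: (edge_of_ends _ _ a) => -[e1 e2]; first by rewrite -e1 in h1; rewrite h1.
by rewrite -e2 in h2; rewrite h2.
Qed.

Lemma walk_all_ends x q (E0 : config) (Q : Z2 -> Prop) : path adjb x q -> all E0 (edges x q) ->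
  Q x -> (forall e, E0 e -> Q (src e) /\ Q (dst e)) -> forall t, t \in x :: q -> Q t.
Proof.
move=> + + + hE; elim: q x => [|z q IH] x /=; first by move=> _ _ Qx t; rewrite inE => /eqP ->.
move=> /andP[a hq] /andP[h1 h2] Qx t; rewrite inE => /orP[/eqP -> //|]; apply: (IH z) => //.
have [hs hd] := hE _ h1; case: (edge_of_ends _ _ a) => -[e1 e2].
  by rewrite -e2 in hd.
by rewrite -e1 in hs.
Qed.

(** A simple path in [E0] uses each edge at most once, and its edges off [p] are free. *)
Lemma cheap_simple_path x y p (E0 : config) (K : seq Z2) : is_path V x p y -> x \in K ->
  conn E0 predT x (pred1 y) ->
  (forall e, E0 e -> [/\ edges_in V e, e \in edges x p \/ w e = 0, src e \in K & dst e \in K]) ->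
  exists q, [/\ is_path V x q y, {subset x :: q <= K}, uniq (x :: q) & ptime w x q <= ptime w x p].
Proof.
move=> hp xK [q [q1 q2 _ /eqP q4]] hE.
(* Membership in [E0] is built into the step relation, so [shortenP] removes loops without leaving
   [E0]. *)
pose r (a b : Z2) := adjb a b && E0 (edge_of a b).
have rq t z : path r z t = path adjb z t && all E0 (edges z t).
  elim: t z => [|u t IH] z //=; rewrite IH /r.
  by case: (adjb z u); case: (E0 _) => //=; case: (path _ _ _).
have rp : path r x q by rewrite rq q1 q2.
move: q4; case/shortenP: rp => s s1 s2 s3 q4.
move: s1; rewrite rq => /andP[s4 s5]; exists s; split=> //.
- have Vx : V x by have /is_pathP [_ _ h] := hp; apply: h; rewrite mem_head.
  apply/is_pathP; split=> //; apply: (walk_all_ends x s E0) => // e /hE [[]] //.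
- by apply: (walk_all_ends x s E0 (fun t => t \in K)) => // e /hE [].
- rewrite !ptimeE; apply: sum_subseq_le.
  + exact: uniq_edges.
  + by move=> e /(edges_in_path _ _ _ _ hp) /w_ge0.
  + by move=> e /(allP s5) /hE [].
Qed.

End Geodesics.

Lemma walk_in_boxc (c : config) N x p : ~ conn c (boxc N x) x (bdryc N x) ->
  path adjb x p -> all c (edges x p) -> all (boxc N x) (x :: p).
Proof.
move=> hno; elim/last_ind: p => [|p z IH].
  by move=> _ _; rewrite /= andbT /boxc /inbox /shift /= !subrr.
rewrite rcons_path -cats1 => /andP[hp a]; rewrite edges_cat all_cat => /andP[hc _].
have hb := IH hp hc; rewrite -cat_cons all_cat hb all_seq1.
have nb : ~~ bdryc N x (last x p) by apply/negP => h; apply: hno; exists p.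
have := allP hb _ (mem_last x p); move: nb a.
rewrite /bdryc /boxc /bdry /inbox /adjb /shift /=; case: (last x p) z => a b [e f] /=; clear; lia.
Qed.

Lemma clusters_bounded (c : config) (s : seq Z2) :
  (forall x, exists N, ~ conn c (boxc N x) x (bdryc N x)) ->
  exists M, forall x, x \in s -> forall p, path adjb x p -> all c (edges x p) ->
    all (inbox M) (x :: p).
Proof.
move=> h; apply: (seq_bound _ (fun x M => forall p, path adjb x p -> all c (edges x p) ->
    all (inbox M) (x :: p))).
  move=> x m n mn hm p h1 h2; apply: sub_all (hm p h1 h2) => z; exact: inbox_le.
move=> x _; have [N hN] := h x; exists (N + absz x.1 + absz x.2)%N => p h1 h2.
apply: sub_all (walk_in_boxc c N x p hN h1 h2) => z.
by rewrite /boxc /inbox /shift /=; clear; lia.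
Qed.

(** * Geodesics from finite clusters of cheap edges *)

Section Cheap.
Context {R : realType}.
Variables (V : set Z2) (w : Edge -> R).
Hypothesis w_ge0 : forall e, edges_in V e -> 0 <= w e.

Definition low (eps : R) : config := fun e => `[< edges_in V e /\ w e <= eps >].

(** Before its first edge of weight above [eps] a path stays in a finite low cluster; that edge
    consumes one unit of the budget, and the induction hypothesis confines the rest. *)
Lemma cheap_paths_bounded (eps : R) : 0 < eps ->
  (forall x, exists N, ~ conn (low eps) (boxc N x) x (bdryc N x)) ->
  forall k m : nat, exists M, forall x, inbox m x -> forall p, path adjb x p ->
    (forall e, e \in edges x p -> edges_in V e) -> ptime w x p <= k%:R * eps ->
    all (inbox M) (x :: p).
Proof.
move=> eps0 hcl; elim=> [|k IH] m.
  have [M hM] := clusters_bounded _ (boxV m) hcl; exists M => x xm p hp hV hT.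
  apply: hM => //; first by rewrite mem_boxV.
  apply/allP => e he; apply/asboolP; split; first exact: hV.
  rewrite mul0r ptimeE (perm_big _ (perm_to_rem he)) big_cons in hT.
  have h : 0 <= \sum_(j <- rem e (edges x p)) w j.
    by rewrite big_seq sumr_ge0 // => i /mem_rem /hV /w_ge0.
  by apply: le_trans (ltW eps0); apply: le_trans hT; rewrite lerDl.
have [M1 hM1] := clusters_bounded _ (boxV m) hcl.
(* The costly edge may leave the box of radius [M1] by one step. *)
have [M2 hM2] := IH M1.+1; exists (maxn M1 M2) => x xm p hp hV hT.
have {}hM1 := hM1 x; rewrite mem_boxV in hM1; have {}hM1 := hM1 xm.
have [hall|hnall] := boolP (all (low eps) (edges x p)).
  by apply: sub_all (hM1 p hp hall) => z; apply: inbox_le; exact: leq_maxl.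
suff [p1 [z [p2 [ep hl hn]]]] : exists p1 z p2, [/\ p = p1 ++ z :: p2,
    all (low eps) (edges x p1) & ~~ low eps (edge_of (last x p1) z)].
  have [hp1 a hp2] : [/\ path adjb x p1, adjb (last x p1) z & path adjb z p2].
    by move: hp; rewrite ep cat_path /= => /and3P[].
  have hb1 := hM1 p1 hp1 hl.
  have zin : inbox M1.+1 z.
    have := allP hb1 _ (mem_last x p1); move: a; rewrite /adjb /inbox.
    case: (last x p1) (z) => ? ? [? ?] /=; clear; lia.
  have eE : edges x p = edges x p1 ++ edge_of (last x p1) z :: edges z p2.
    by rewrite ep edges_cat.
  have hV2 e : e \in edges z p2 -> edges_in V e.
    by move=> he; apply: hV; rewrite eE mem_cat inE he !orbT.
  have hVe : edges_in V (edge_of (last x p1) z).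
    by apply: hV; rewrite eE mem_cat inE eqxx orbT.
  have hw : eps < w (edge_of (last x p1) z).
    by rewrite ltNge; apply: contraNN hn => h; apply/asboolP.
  have hb2 : all (inbox M2) (z :: p2).
    apply: hM2 => //; move: hT; rewrite !ptimeE eE big_cat big_cons /=.
    have h1 : 0 <= \sum_(j <- edges x p1) w j.
      rewrite big_seq sumr_ge0 // => i hi; apply: w_ge0; apply: hV.
      by rewrite eE mem_cat hi.
    rewrite -natr1 mulrDl mul1r; move: hw h1; lra.
  rewrite ep -cat_cons all_cat; apply/andP; split.
    by apply: sub_all hb1 => t; apply: inbox_le; exact: leq_maxl.
  by apply: sub_all hb2 => t; apply: inbox_le; exact: leq_maxr.
elim: p x {hp hV hT xm hM1} hnall => [|z p IHp] x //=.
have [h|h] := boolP (low eps (edge_of x z)).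
  by move=> /IHp [p1 [t [p2 [-> h1 h2]]]]; exists (z :: p1), t, p2; rewrite /= h.
by move=> _; exists [::], z, p.
Qed.

(** All paths no costlier than [p0] lie in one box, so it suffices to remove their loops. *)
Lemma geodesic_of_low_clusters (eps : R) x y p0 : 0 < eps ->
  (forall x, exists N, ~ conn (low eps) (boxc N x) x (bdryc N x)) ->
  is_path V x p0 y -> exists p, geodesic V w x p y.
Proof.
move=> eps0 hcl hp0; have [m xm] := inbox_ex x.
pose k := Num.bound `|ptime w x p0 / eps|.
have hk : ptime w x p0 <= k%:R * eps.
  by rewrite -ler_pdivrMr // ltW // (le_lt_trans (ler_norm _)) // archi_boundP ?normr_ge0.
have [M hM] := cheap_paths_bounded eps eps0 hcl k m.
apply: (geodesic_of_finite V w x y (boxV M) p0 hp0) => p hp hT.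
have /is_pathP [h1 h2 h3] := hp.
have hin : all (inbox M) (x :: p).
  by apply: hM => //; [move=> e; exact: edges_in_path hp|exact: le_trans hT hk].
apply: (cheap_simple_path V w w_ge0 x y p (fun e => e \in edges x p) (boxV M)) => //.
- by rewrite mem_boxV (allP hin) // mem_head.
- by exists p; split; [|exact/allP|exact: all_predT|rewrite /= h2].
- move=> e he; have [s1 s2] := edges_mem _ _ _ h1 he.
  split; [exact: edges_in_path hp he|by left|by rewrite mem_boxV (allP hin)|by rewrite mem_boxV (allP hin)].
Qed.

End Cheap.

(** * Geodesics from finite dual clusters *)

(** Used in contrapositive form: a cut met an odd number of times by a chain contains an edge of odd
    multiplicity. The induction discards all copies of one edge at a time. *)
Lemma even_count_cut (D : pred Edge) (L : seq Edge) :
  (forall e, D e -> ~~ odd (count_mem e L)) -> ~~ odd (count D L).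
Proof.
have [n hn] := ubnP (size L); elim: n L hn => // n IH [|e L'] // hn h.
set L := e :: L' in hn h *; pose L2 := [seq i <- L | predC1 e i].
have -> : count D L = (count D [seq i <- L | pred1 e i] + count D L2)%N.
  by rewrite -count_cat; apply/permP; rewrite perm_sym; apply/permPl; exact: perm_filterC.
rewrite oddD negb_add; apply/eqP; rewrite [RHS](_ : _ = false); last first.
  apply/negbTE/IH => [|i Di].
    rewrite -ltnS; apply: leq_trans hn; rewrite ltnS /L2 /L /= eqxx /= ltnS size_filter; exact: count_size.
  rewrite count_filter; have [->|ie] := eqVneq i e.
    by rewrite (eq_count (a2 := pred0)) ?count_pred0 // => j /=; case: eqP.
  rewrite (eq_count (a2 := pred1 i)); first exact: h.
  by move=> j /=; case: eqP => // ->; rewrite ie.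
apply/negbTE; rewrite count_filter; have [De|nDe] := boolP (D e).
  rewrite (eq_count (a2 := pred1 e)); first exact: h.
  by move=> j /=; case: eqP => [->|]; rewrite ?De ?andbF.
rewrite (eq_count (a2 := pred0)) ?count_pred0 // => j /=.
by case: eqP => [->|]; rewrite ?(negPf nDe) ?andbF.
Qed.

Definition face_bd (f : Z2) : seq Edge :=
  [:: (f, false); (f, true); ((f.1 + 1, f.2), true); ((f.1, f.2 + 1), false)].

Definition cut (A : pred Z2) : pred Edge := fun e => A (src e) (+) A (dst e).

Lemma odd_cut_face A f : odd (count (cut A) (face_bd f)) = false.
Proof.
rewrite /= /cut /src /dst /=; case: f => i j /=.
by case: (A (i, j)); case: (A (i + 1, j)); case: (A (i, j + 1)); case: (A (i + 1, j + 1)).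
Qed.

Lemma odd_cut_walk A x p : path adjb x p ->
  odd (count (cut A) (edges x p)) = A x (+) A (last x p).
Proof.
elim: p x => [|z p IH] x /=; first by rewrite addbb.
move=> /andP[a /IH h]; rewrite oddD h oddb /cut.
by case: (edge_of_ends _ _ a) => -[<- <-]; case: (A x); case: (A z); case: (A _).
Qed.

Lemma count_face_bd e f : count_mem (dl e) (face_bd f) = ((f == src e) + (f == dst e))%N.
Proof.
case: e f => [[i j] []] [a b]; rewrite /dl /face_bd /src /dst /= !xpair_eqE /=; lia.
Qed.

(** The boundary mod 2 of a set of faces: an edge shared by two of its faces cancels. *)
Lemma count_faces_bd e (F : seq Z2) : uniq F ->
  odd (count_mem (dl e) (flatten [seq face_bd f | f <- F])) = (src e \in F) (+) (dst e \in F).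
Proof.
elim: F => [|f F IH] // /andP[fF uF]; rewrite map_cons -cat1s flatten_cat [flatten [:: _]]/flatten /foldr cats0 count_cat oddD (IH uF) count_face_bd oddD !oddb.
rewrite !inE ![f == _]eq_sym.
case: eqP => [e1|_]; case: eqP => [e2|_] //=; rewrite ?e1 ?e2 ?(negPf fF) ?addbF ?addbT //.
all: by case: (_ \in F) => //; case: (_ \in F).
Qed.

Lemma src_dl e : src (dl e) = dst e.
Proof. by case: e => [[i j] []]. Qed.

Lemma dst_dl e : dst (dl e) = ((src e).1 + 1, (src e).2 + 1).
Proof. by case: e => [[i j] []]. Qed.

Lemma nu_level x p i j : path adjb x p ->
  (forall z, z \in x :: p -> z.2 <= j) \/ (forall z, z \in x :: p -> j < z.2) ->
  nu x p (i, j) = false.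
Proof.
move=> hp h; rewrite /nu (_ : count _ _ = 0%N) //; apply/eqP; rewrite -leqn0 leqNgt -has_count.
apply/negP => /hasP [[[a b] c] he] /= /and3P[hc /eqP hb _].
have [h1 h2] := edges_mem _ _ _ hp he; move: h1 h2; rewrite /src /dst /= hc hb => h1 h2.
by case: h => h; have := h _ h1; have := h _ h2 => /=; lia.
Qed.

(* [wind x p r] is the winding parity around faces of the loop formed by two
   walks [p] and [r] with the same endpoints. *)
Definition wind x p r (f : Z2) : bool := nu x p f (+) nu x r f.

(** The endpoint terms of [nu_step] cancel because the two walks share their endpoints. *)
Lemma wind_step x p r e : path adjb x p -> path adjb x r -> last x p = last x r ->
  wind x p r (dst e) = wind x p r (src e) (+) (cnt x p (dl e) (+) cnt x r (dl e)).
Proof.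
move=> hp hr hl; rewrite /wind (nu_step _ _ _ hp) (nu_step _ _ _ hr) hl.
by case: (nu _ _ _); case: (nu _ _ _); case: (cnt _ _ _); case: (cnt _ _ _); case: (_ && _).
Qed.

(** On the left, below and above, neither walk meets the half-line; on the right both crossing
    parities are given by the common endpoints. *)
Lemma wind_out x p r M f : path adjb x p -> path adjb x r -> last x p = last x r ->
  all (inbox M) (x :: p) -> all (inbox M) (x :: r) -> ~~ inbox M f -> wind x p r f = false.
Proof.
move=> hp hr hl bp br; case: f => i j hf.
have hin q : all (inbox M) (x :: q) -> forall z : Z2, z \in x :: q ->
    [/\ - M%:Z <= z.1, z.1 <= M%:Z, - M%:Z <= z.2 & z.2 <= M%:Z].
  move=> hq z /(allP hq); rewrite /inbox => hz; clear -hz; split; lia.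
have [h|[h|[h|h]]] : i < - M%:Z \/ M%:Z < i \/ j < - M%:Z \/ M%:Z < j.
  by move: hf; rewrite /inbox /=; clear; lia.
- have k q : all (inbox M) (x :: q) -> forall z, z \in x :: q -> i < z.1.
    by move=> /hin hq z /hq [k _ _ _]; exact: lt_le_trans h k.
  by rewrite /wind !nu_far_left //; exact: k.
- have k q : all (inbox M) (x :: q) -> forall z, z \in x :: q -> z.1 <= i.
    by move=> /hin hq z /hq [_ k _ _]; exact: le_trans k (ltW h).
  by rewrite /wind !nu_far_right ?hl ?addbb //; exact: k.
- have k q : all (inbox M) (x :: q) -> forall z, z \in x :: q -> j < z.2.
    by move=> /hin hq z /hq [_ _ k _]; exact: lt_le_trans h k.
  by rewrite /wind !nu_level //; right; exact: k.
- have k q : all (inbox M) (x :: q) -> forall z, z \in x :: q -> z.2 <= j.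
    by move=> /hin hq z /hq [_ _ _ k]; exact: le_trans k (ltW h).
  by rewrite /wind !nu_level //; left; exact: k.
Qed.

Section Dual.
Context {R : realType}.
Variables (V : set Z2) (w : Edge -> R).
Hypothesis w_ge0 : forall e, edges_in V e -> 0 <= w e.
Hypothesis Vc_inf : ~ finite_set (~` V).
Hypothesis Vc_conn : connected_set (~` V).

Definition high_dual : config := fun e => `[< edges_in V (dl e) /\ 0 < w (dl e) >].

Lemma wind_step_avoid x y p r e : is_path V x p y -> is_path V x r y ->
  ~ V (src (dl e)) \/ ~ V (dst (dl e)) -> wind x p r (dst e) = wind x p r (src e).
Proof.
move=> hp hr hV; have /is_pathP [p1 p2 p3] := hp; have /is_pathP [r1 r2 r3] := hr.
have c q : is_path V x q y -> cnt x q (dl e) = false.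
  move=> hq; apply/negP => /cnt_mem /(edges_in_path _ _ _ _ _ hq) [h1 h2].
  by case: hV.
by rewrite wind_step ?p2 ?r2 // !c // !addbF.
Qed.

(** A walk outside [V], read as a walk of faces through their lower-left corners, crosses only edges
    with an endpoint outside [V], so the winding is constant along it. As the complement is infinite
    and connected, such a walk leads out of the box containing both paths. *)
Lemma wind_complement x y p r v : is_path V x p y -> is_path V x r y -> ~ V v ->
  wind x p r v = false.
Proof.
move=> hp hr nv; have /is_pathP [p1 p2 p3] := hp; have /is_pathP [r1 r2 r3] := hr.
have [M hM] := inbox_seq ((x :: p) ++ (x :: r)).
have bp : all (inbox M) (x :: p) by apply/allP => z hz; apply: hM; rewrite mem_cat hz.
have br : all (inbox M) (x :: r) by apply/allP => z hz; apply: hM; rewrite mem_cat hz orbT.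
have [v0 nv0 out0] : exists2 v0, ~ V v0 & ~~ inbox M v0.
  apply: contrapT => h; apply: Vc_inf; apply: (@sub_finite_set _ _ [set` boxV M]).
    move=> v0 /= nv0; rewrite mem_boxV; apply: contrapT => /negP ho.
    by apply: h; exists v0.
  exact: finite_seq.
have [q hq] := Vc_conn v v0 nv nv0.
suff -> : wind x p r v = wind x p r v0 by apply: wind_out bp br _ => //; rewrite p2 r2.
elim: q v nv hq => [|z q IH] v nv /=; first by move=> [_ ->].
move=> [_ [/adjP a hq]].
have nz : ~ V z by case: (q) hq => [|? ?] /= [].
rewrite -(IH z nz hq).
have := wind_step_avoid x y p r (edge_of v z) hp hr.
rewrite src_dl; case: (edge_of_ends _ _ a) => -[<- <-] -> //; by left.
Qed.

(** [wind_complement] treats the face whose lower-left corner is missing from [V]; the other faces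
    around that vertex are reached by turning about it, across edges that are not in [V]. *)
Lemma wind_corner x y p r e : is_path V x p y -> is_path V x r y ->
  ~ V (src (dl e)) \/ ~ V (dst (dl e)) ->
  wind x p r (src e) = false /\ wind x p r (dst e) = false.
Proof.
move=> hp hr hV; rewrite (wind_step_avoid _ _ _ _ _ hp hr hV).
suff -> : wind x p r (src e) = false by [].
case: (hV) => h.
  rewrite -(wind_step_avoid _ _ _ _ _ hp hr hV) -src_dl.
  exact: wind_complement hp hr h.
rewrite dst_dl in h; set f := src e in h *.
have h1 := wind_step_avoid x y p r (f, false) hp hr.
have h2 := wind_step_avoid x y p r ((f.1 + 1, f.2), true) hp hr.
rewrite dst_dl /dst /src /= in h1; rewrite src_dl /dst /src /= in h2.
rewrite -h1; last by right.
rewrite -h2; last by left.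
exact: wind_complement hp hr h.
Qed.

Lemma geodesic_of_dual_clusters x y r : is_path V x r y ->
  (forall f, exists N, ~ conn high_dual (boxc N f) f (bdryc N f)) ->
  exists p, geodesic V w x p y.
Proof.
move=> hr hcl; have /is_pathP [r1 r2 r3] := hr.
(* [Bf] lists the faces bordering [r]; the union [C] of their dual clusters is bounded and depends
   on [r] alone. *)
pose Bf := [seq src (dli e) | e <- edges x r] ++ [seq dst (dli e) | e <- edges x r].
pose C f := `[< exists2 b, b \in Bf & conn high_dual predT b (pred1 f) >].
have Cstep e : high_dual e -> C (src e) = C (dst e).
  move=> he; apply/idP/idP => /asboolP [b bB hb]; apply/asboolP; exists b => //;
  apply: conn_trans hb _; [|apply: conn_sym]; exists [:: dst e]; rewrite /= edge_of_src_dst he adjb_ends /=; split=> //=.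
have Cr e : dl e \in edges x r -> C (src e) /\ C (dst e).
  have refl b : b \in Bf -> C b by move=> bB; apply/asboolP; exists b => //; exists [::]; split=> //=.
  move=> he; split; apply: refl; rewrite mem_cat -(dlK e).
    by rewrite (map_f (fun e => src (dli e)) he).
  by rewrite (map_f (fun e => dst (dli e)) he) orbT.
have [M hM] := clusters_bounded _ Bf hcl.
have CM f : C f -> inbox M f.
  move=> /asboolP [b bB [q [q1 q2 _ /eqP <-]]].
  by apply: (allP (hM b bB q q1 q2)); exact: mem_last.
(* The vertex list is fixed before [p]. A corner of a face in the box of radius [M] may have radius
   [M + 1], and [x] is added since the box need not contain it when [r] is empty. *)
apply: (geodesic_of_finite V w x y (x :: boxV M.+1) r hr) => p hp _.
have /is_pathP [p1 p2 p3] := hp; have hl : last x p = last x r by rewrite p2 r2.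
pose u f := wind x p r f && ~~ C f.
have [M' hM'] := inbox_seq ((x :: p) ++ (x :: r)).
have bp : all (inbox M') (x :: p) by apply/allP => z hz; apply: hM'; rewrite mem_cat hz.
have br : all (inbox M') (x :: r) by apply/allP => z hz; apply: hM'; rewrite mem_cat hz orbT.
pose F := [seq f <- undup (boxV M') | u f].
have memF f : (f \in F) = u f.
  rewrite mem_filter mem_undup mem_boxV; case: (boolP (u f)) => //= /andP[hw _].
  by apply: contraTT hw => ho; rewrite (wind_out _ _ _ _ _ p1 r1 hl bp br ho).
have uF : uniq F by rewrite filter_uniq // undup_uniq.
(* The chain made of [p] and of the boundaries of the odd faces outside [C]; [E0] is its reduction
   mod 2. *)
pose L := edges x p ++ flatten [seq face_bd f | f <- F].
pose E0 : config := fun e => odd (count_mem e L).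
have E0E e : E0 (dl e) = cnt x p (dl e) (+) (u (src e) (+) u (dst e)).
  by rewrite /E0 /L count_cat oddD count_faces_bd // !memF.
have hw e := wind_step x p r e p1 r1 hl.
have wV e : wind x p r (src e) || wind x p r (dst e) -> edges_in V (dl e).
  move=> h; split; apply: contrapT => nV.
    by have [h1 h2] := wind_corner x y p r e hp hr (or_introl nV); rewrite h1 h2 in h.
  by have [h1 h2] := wind_corner x y p r e hp hr (or_intror nV); rewrite h1 h2 in h.
(* An edge of [E0] off [p] borders a face of odd winding, which [wind_corner] excludes when an
   endpoint is outside [V]. *)
have E0V e : E0 (dl e) -> edges_in V (dl e).
  rewrite E0E; have [/cnt_mem h _|_] := boolP (cnt x p (dl e)); first exact: edges_in_path hp h.
  rewrite /u => h; apply: wV; move: h.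
  by case: (wind x p r (src e)); case: (wind x p r (dst e)).
apply: (cheap_simple_path V w w_ge0 x y p E0) => //; first by rewrite mem_head.
  (* [A] is the component of [x] in [E0]. If it missed [y], its cut would be met oddly by [p] and
     evenly by each face boundary, so a cut edge would have odd multiplicity, that is, lie in
     [E0]. *)
  pose A z := `[< conn E0 predT x (pred1 z) >].
  have Ax : A x by apply/asboolP; exists [::]; split=> //=.
  apply/asboolP; rewrite -/(A y); apply: contraT => nAy.
  have : odd (count (cut A) L).
    rewrite /L count_cat oddD odd_cut_walk // p2 Ax (negPf nAy) /=.
    elim: (F) => [|f F' IH] //.
    by rewrite map_cons -cat1s flatten_cat [flatten [:: _]]/flatten /foldr cats0 count_cat oddD odd_cut_face.
  rewrite (negPf (even_count_cut (cut A) L _)) // => e; rewrite /cut => hcut.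
  apply/negP => he; move: hcut.
  have Astep : A (src e) = A (dst e).
    apply/idP/idP => /asboolP h; apply/asboolP; apply: conn_trans h _; [|apply: conn_sym];
    exists [:: dst e]; rewrite /= edge_of_src_dst adjb_ends /=; split=> //=; by rewrite andbT.
  by rewrite Astep addbb.
move=> e'; rewrite -(dliK e'); set e := dli e' => he.
have eV := E0V e he.
(* Away from [C], [u] is the winding, whose jump across an edge off [r] equals the parity of [p]
   there; the two contributions to [E0] cancel. *)
have nearC : C (src e) || C (dst e).
  apply: contraLR he; rewrite negb_or => /andP[c1 c2]; rewrite E0E /u c1 c2 !andbT hw.
  have -> : cnt x r (dl e) = false.
    by apply/negP => /cnt_mem /Cr [h _]; rewrite h in c1.
  by case: (cnt _ _ _); case: (wind _ _ _ _).
split=> //.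
- have [h|hp'] := boolP (dl e \in edges x p); [by left|right].
  have c0 : cnt x p (dl e) = false by apply/negP => /cnt_mem h; rewrite h in hp'.
  have hu : u (src e) (+) u (dst e) by move: he; rewrite E0E c0.
  have cr : cnt x r (dl e) = false.
    by apply/negP => /cnt_mem /Cr [h1 h2]; move: hu; rewrite /u h1 h2 !andbF.
  (* A positive weight would join the two faces in one dual cluster, both in [C] or both outside;
     having equal winding, they would have equal [u]. *)
  have hh : ~ high_dual e.
    move=> hd; move: hu; rewrite /u (Cstep e hd) hw c0 cr !addbF addbb //.
  apply/eqP; rewrite eq_le w_ge0 // andbT leNgt; apply/negP => h; apply: hh.
  exact/asboolP.
- rewrite inE mem_boxV src_dl; apply/orP; right; move: nearC => /orP[] /CM;
  by case: (e) => [[i j] []]; rewrite /src /dst /inbox /=; clear; lia.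
- rewrite inE mem_boxV dst_dl; apply/orP; right; move: nearC => /orP[] /CM;
  by case: (e) => [[i j] []]; rewrite /src /dst /inbox /=; clear; lia.
Qed.

End Dual.

(** * Dichotomy on the mass at zero *)

Section Dichotomy.
Context {d : measure_display} {T : measurableType d} {R : realType}.
Variables (P : probability T R) (S : set Edge) (X : Edge -> T -> R).
Hypothesis X_meas : forall e, S e -> measurable_fun setT (X e).

(** One edge decides, the laws being equal. If a nonpositive weight has probability below 1/2,
    continuity from above along the bounds [1 / (n + 1)] provides [eps]. *)
Lemma zero_atom_dichotomy : identically_distributed P S X ->
  (forall e, S e -> (P (X e @^-1` `]0%R, +oo[) <= (2^-1)%:E)%E) \/
  (exists2 eps, 0 < eps & forall e, S e -> (P (X e @^-1` `]-oo, eps]) <= (2^-1)%:E)%E).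
Proof.
move=> X_id; have [[e0 Se0]|no] := pselect (exists e, S e); last by left=> e Se; case: no; exists e.
have mX e (B : set R) : S e -> measurable B -> measurable (X e @^-1` B).
  by move=> Se mB; rewrite -[_ @^-1` _]setTI; apply: X_meas.
have [h|h] := leP (2^-1)%:E (P (X e0 @^-1` `]-oo, 0])).
  left=> e Se; rewrite (X_id e e0) //.
  have -> : X e0 @^-1` `]0, +oo[ = ~` (X e0 @^-1` `]-oo, 0]).
    by rewrite preimage_setC setCitvl.
  rewrite probability_setC; last exact: mX.
  have mE : P (X e0 @^-1` `]-oo, 0]) = (fine (P (X e0 @^-1` `]-oo, 0])))%:E.
    by rewrite fineK // fin_num_measure //; exact: mX.
  by move: h; rewrite mE -EFinB !lee_fin; lra.
right; pose F n := X e0 @^-1` `]-oo, n.+1%:R^-1].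
have mF n : measurable (F n) by apply: mX.
have capF : \bigcap_n F n = X e0 @^-1` `]-oo, 0].
  apply/seteqP; split => t /=; rewrite in_itv /=.
    move=> ht; rewrite leNgt; apply/negP => t0.
    have := ht (Num.bound (X e0 t)^-1) I; rewrite /F /= in_itv /= leNgt => /negP; apply.
    rewrite -[ltRHS]invrK ltf_pV2 ?posrE ?invr_gt0 ?ltr0n //.
    apply: lt_trans (archi_boundP _) _; first by rewrite invr_ge0 ltW.
    by rewrite ltr_nat.
  move=> ht n _; rewrite /F /= in_itv /=; apply: le_trans ht _.
  by rewrite invr_ge0 ler0n.
have cv : (P \o F) x @[x --> \oo] --> P (\bigcap_n F n).
  apply: nonincreasing_cvg_mu => //.
  - by rewrite -ge0_fin_numE ?measure_ge0 // fin_num_measure.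
  - exact: bigcapT_measurable.
  - move=> n m nm; apply/subsetPset => t; rewrite /F /= !in_itv /= => /le_trans; apply.
    by rewrite lef_pV2 ?posrE ?ltr0n // ler_nat.
rewrite capF in cv.
have [n _ hn] := cv _ (open_nbhs_nbhs (conj (@open_ereal_lt_ereal R (2^-1)%:E) h)).
exists n.+1%:R^-1; first by rewrite invr_gt0 ltr0n.
move=> e Se; rewrite (X_id e e0) //; apply: ltW; exact: (hn n (leqnn n)).
Qed.
End Dichotomy.

(** Applied to [dl], this makes the weights an independent family indexed by dual edges. *)
Lemma mutually_independent_reindex (d : measure_display) (T : measurableType d) (R : realType)
  (P : probability T R) (I J : eqType) (S : set I) (X : I -> T -> R) (f : J -> I) (g : I -> J) :
  cancel f g -> cancel g f ->
  mutually_independent P S X ->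
  mutually_independent P (f @^-1` S) (fun j => X (f j)).
Proof.
move=> fK gK h s B us hs mB.
have hs' i : i \in map f s -> S i by move=> /mapP [j js ->]; exact: hs.
have := h (map f s) (B \o g) (_ : uniq (map f s)) hs' (fun i => mB (g i)).
rewrite map_inj_uniq; last exact: can_inj fK.
move=> /(_ us); rewrite !big_map.
by under eq_bigr do rewrite /= fK; under [X in _ = X]eq_bigr do rewrite /= fK.
Qed.

Theorem theoremB2 (V : set Z2)
  (V_inf : ~ finite_set V) (V_conn : connected_set V)
  (Vc_inf : ~ finite_set (~` V)) (Vc_conn : connected_set (~` V))
  (d : measure_display) (T : measurableType d) (R : realType)
  (P : probability T R) (X : Edge -> T -> R)
  (X_meas : forall e, edges_in V e -> measurable_fun setT (X e))
  (X_nonneg : forall e, edges_in V e -> forall t, 0 <= X e t)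
  (X_indep : mutually_independent P (edges_in V) X)
  (X_id : identically_distributed P (edges_in V) X) :
  forall x y, V x -> V y ->
    {ae P, forall t, exists p, geodesic V (fun e => X e t) x p y}.
Proof.
move=> x y Vx Vy; have [p0 hp0] := V_conn x y Vx Vy.
(* In the first case dual edges crossing an edge of positive weight are dominated by fair coins, in
   the second case edges of weight at most [eps]. *)
case: (zero_atom_dichotomy P (edges_in V) X X_meas X_id) => [hhigh|[eps eps0 hlow]].
- have hind : mutually_independent P (dl @^-1` edges_in V) (fun e => X (dl e)).
    exact: (mutually_independent_reindex _ _ _ _ _ _ _ _ dl dli dlK dliK).
  have := ae_finite_clusters P (dl @^-1` edges_in V) (fun e => X (dl e)) `]0, +oo[
    (fun e => X_meas (dl e)) hind (measurable_itv _) (fun e => hhigh (dl e)).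
  apply: filterS => t ht.
  apply: (geodesic_of_dual_clusters V _ _ Vc_inf Vc_conn x y p0 hp0).
    by move=> e /X_nonneg.
  move=> f; have [N hN] := ht f; exists N => h; apply: hN; apply: conn_sub h => //.
  by move=> e /asboolP [h1 h2]; apply/asboolP; split=> //=; rewrite in_itv /= h2.
have := ae_finite_clusters P (edges_in V) X `]-oo, eps] X_meas X_indep (measurable_itv _) hlow.
apply: filterS => t ht.
apply: (geodesic_of_low_clusters V _ _ eps x y p0 eps0 _ hp0).
  by move=> e /X_nonneg.
move=> f; have [N hN] := ht f; exists N => h; apply: hN; apply: conn_sub h => //.
Qed.
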